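(* Let $k$ be a (not necessarily algebraically closed) field of characteristic two, let $K=k((t))$ with fixed algebraic closure $K^{\mathrm{alg}}$, and let $L\subseteq K^{\mathrm{alg}}$ be a totally ramified Galois extension of $K$ with $\mathrm{Gal}(L|K)\cong D_4$. Let $F,G,H\in K$ and $q,r,s\in K^{\mathrm{alg}}$ be such that $q^2+q=F$, $r^2+r=Gq+H$, $s^2+s=G$, and $L=K[q,r,s]$; assume that each of $f=\deg_{t^{-1}}F$, $g=\deg_{t^{-1}}G$ and $d=\deg_{t^{-1}}(F+G)$ is both positive and odd, that $h=\deg_{t^{-1}}H$ is not both positive and even, and that $f\le g$. Then the lower ramification breaks of $L$ over $K$ are $$\ell_1=\min\{d,f\},\quad \ell_2=2g-\min\{d,f\},\quad \ell_3=4\max\{f+g,h\}-2g-\min\{d,f\},$$ and the upper ramification breaks of $L$ over $K$ are $$u_1=\min\{d,f\},\quad u_2=g,\quad u_3=\max\{f+g,h\}.$$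
   Context: $D_4$ is the dihedral group of order 8. For a nonzero $X\in k((t))$, $\deg_{t^{-1}}X$ is the largest integer $n$ such that $t^{-n}$ has nonzero coefficient in $X$ (i.e. minus the $t$-adic valuation); the zero element is regarded as having non-positive degree. For a totally ramified Galois extension with group $\Gamma$ of order $2^n$, let $\Gamma_j$ and $\Gamma^j$ be the lower and upper (Serre) numbering ramification groups. The $i$th lower ramification break is $\ell_i=\max\{\nu: |\Gamma_\nu|\ge 2^{n+1-i}\}$ and the $i$th upper ramification break is $u_i=\max\{\nu: |\Gamma^\nu|\ge 2^{n+1-i}\}$, for $1\le i\le n$. *)

(* Defs.v *)
From HB Require Import structures.
From mathcomp Require Import all_boot all_order all_fingroup all_algebra.
From mathcomp Require Import all_solvable all_field.
From mathcomp Require Import boolp classical_sets functions cardinality.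
From mathcomp Require Import fsbigop reals.
From mathcomp Require Import zify ring.

Set Implicit Arguments.
Unset Strict Implicit.
Unset Printing Implicit Defensive.

Import Order.TTheory GRing.Theory Num.Theory.

Local Open Scope ring_scope.

(* The field k((t)): formal series indexed by int, zero below some index. *)

Definition vanish_below (k : fieldType) (c : int -> k) (a : int) : Prop :=
  forall i, i < a -> c i = 0.

Record laurent (k : fieldType) := Laurent {
  lcoef :> int -> k;
  laurentP : exists a, vanish_below lcoef a }.

HB.instance Definition _ (k : fieldType) := gen_eqMixin (laurent k).
HB.instance Definition _ (k : fieldType) := gen_choiceMixin (laurent k).

Section LaurentField.
Variable k : fieldType.
Implicit Types X Y Z : laurent k.

Lemma laurent_ext X Y : (forall n, X n = Y n) -> X = Y.
Proof.
case: X Y => [c hc] [d hd] /= /funext cd; rewrite cd in hc *.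
by congr Laurent; exact: Prop_irrelevance.
Qed.

Lemma vanish_belowW (c : int -> k) a b :
  a <= b -> vanish_below c b -> vanish_below c a.
Proof. by move=> ab cb i ia; apply: cb; exact: lt_le_trans ab. Qed.

Lemma common_bound (c d : int -> k) :
  (exists a, vanish_below c a) -> (exists a, vanish_below d a) ->
  exists a, vanish_below c a /\ vanish_below d a.
Proof.
move=> [a ca] [b db]; exists (Num.min a b).
by split; [apply: vanish_belowW ca|apply: vanish_belowW db];
   rewrite ge_min lexx ?orbT.
Qed.

Fact laddP X Y : exists a, vanish_below (fun n => X n + Y n) a.
Proof.
have [a [Xa Ya]] := common_bound (laurentP X) (laurentP Y).
by exists a => i ia; rewrite Xa// Ya// addr0.
Qed.

Fact loppP X : exists a, vanish_below (fun n => - X n) a.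
Proof. by have [a Xa] := laurentP X; exists a => i ia; rewrite Xa// oppr0. Qed.

Fact lmonomP (n : int) : exists a, vanish_below (fun i => (i == n)%:R : k) a.
Proof. by exists n => i; rewrite lt_neqAle => /andP[/negbTE ->]. Qed.

Fact lzeroP : exists a, vanish_below (fun=> 0 : k) a.
Proof. by exists 0. Qed.

Definition lzero := Laurent lzeroP.
Definition lmonom n := Laurent (lmonomP n).
Definition ladd X Y := Laurent (laddP X Y).
Definition lopp X := Laurent (loppP X).

(* All but finitely many terms vanish. *)
Definition cauchy_prod (X Y : int -> k) (n : int) : k :=
  \sum_(i \in [set: int]) X i * Y (n - i).

Lemma cauchy_prodE (c d : int -> k) a b (m : nat) n :
  vanish_below c a -> vanish_below d b -> n - a - b < m%:Z ->
  cauchy_prod c d n = \sum_(i < m) c (a + i%:Z) * d (n - a - i%:Z).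
Proof.
move=> ca db nm.
rewrite /cauchy_prod (fsbigE [seq a + i%:Z | i <- iota 0 m]).
- rewrite big_map big_mkcond/= -(big_mkord predT (fun i : nat => c (a + i%:Z) * d (n - a - i%:Z))).
  rewrite /index_iota subn0; apply: eq_bigr => i _.
  by rewrite in_setT opprD addrA.
- by rewrite map_inj_uniq ?iota_uniq// => i j; lia.
- by [].
- move=> i _ /=; have [ia|ai] := ltP i a; first by rewrite ca// mul0r.
  have [nib|bni] := ltP (n - i) b; first by rewrite db// mulr0.
  case/negP; apply/mapP; exists `|i - a|%N; last by lia.
  by rewrite mem_iota; lia.
Qed.

Lemma cauchy_prod_vanish (c d : int -> k) a b :
  vanish_below c a -> vanish_below d b ->
  vanish_below (cauchy_prod c d) (a + b).
Proof.
move=> ca db n nab; rewrite (cauchy_prodE (m := 0) ca db) ?big_ord0//.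
by lia.
Qed.

Fact lmulP X Y : exists a, vanish_below (cauchy_prod X Y) a.
Proof.
have [[a Xa] [b Yb]] := (laurentP X, laurentP Y).
by exists (a + b); exact: cauchy_prod_vanish.
Qed.

Definition lmul X Y := Laurent (lmulP X Y).

Let trunc (c : int -> k) a n : {poly k} := \poly_(i < n.+1) c (a + i%:Z).

Let cauchy_prod_trunc (c d : int -> k) a b (n p : nat) :
  vanish_below c a -> vanish_below d b -> (p <= n)%N ->
  cauchy_prod c d (a + b + p%:Z) = (trunc c a n * trunc d b n)`_p.
Proof.
move=> ca db pn; rewrite (cauchy_prodE (m := p.+1) ca db); last by lia.
rewrite coefM; apply: eq_bigr => i _; rewrite !coef_poly.
have ip := ltn_ord i; rewrite !ifT; try lia.
by congr (_ * d _); lia.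
Qed.

Let coefM_eq (p p' q q' : {poly k}) (n : nat) :
  (forall i, (i <= n)%N -> p`_i = p'`_i) ->
  (forall i, (i <= n)%N -> q`_i = q'`_i) -> (p * q)`_n = (p' * q')`_n.
Proof.
move=> pp' qq'; rewrite !coefM; apply: eq_bigr => i _.
by rewrite pp' ?qq'//; have := ltn_ord i; lia.
Qed.

Fact lmulC : commutative lmul.
Proof.
move=> X Y; apply: laurent_ext => n /=.
have [[a Xa] [b Yb]] := (laurentP X, laurentP Y).
have [nab|abn] := ltP n (a + b).
  rewrite (cauchy_prod_vanish Xa Yb)// (cauchy_prod_vanish Yb Xa)//.
  by rewrite addrC.
have -> : n = a + b + `|(n - (a + b))%R|%N%:Z by lia.
rewrite (cauchy_prod_trunc Xa Yb (leqnn _)) [a + b]addrC.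
by rewrite (cauchy_prod_trunc Yb Xa (leqnn _)) mulrC.
Qed.

Fact lmulA : associative lmul.
Proof.
move=> X Y Z; apply: laurent_ext => n /=; apply/esym.
have [[[a Xa] [b Yb]] [c Zc]] := (laurentP X, laurentP Y, laurentP Z).
have XY := cauchy_prod_vanish Xa Yb; have YZ := cauchy_prod_vanish Yb Zc.
have [nab|abn] := ltP n (a + b + c).
  rewrite (cauchy_prod_vanish XY Zc)// (cauchy_prod_vanish Xa YZ)//.
  by rewrite addrA.
set m := `|(n - (a + b + c))%R|%N.
have -> : n = a + b + c + m%:Z by lia.
rewrite (cauchy_prod_trunc XY Zc (leqnn m)).
rewrite -[a + b + c]addrA (cauchy_prod_trunc Xa YZ (leqnn m)).
transitivity (trunc X a m * (trunc Y b m * trunc Z c m))`_m; last first.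
  apply: coefM_eq => // i im.
  by rewrite [RHS]coef_poly ltnS im (cauchy_prod_trunc Yb Zc im).
rewrite mulrA; apply: coefM_eq => // i im.
by rewrite [LHS]coef_poly ltnS im (cauchy_prod_trunc Xa Yb im).
Qed.

Fact lmul1 : left_id (lmonom 0) lmul.
Proof.
move=> X; apply: laurent_ext => n /=; have [b Xb] := laurentP X.
have one0 : vanish_below (fun i : int => (i == 0)%:R : k) 0.
  by move=> i; rewrite lt_neqAle => /andP[/negbTE ->].
rewrite (cauchy_prodE (m := `|n - b|.+1) one0 Xb); last by lia.
rewrite big_ord_recl big1 => [|i _].
  by rewrite /= !addr0 mul1r; congr (X _); lia.
by rewrite [_ == _](_ : _ = false) ?mul0r//; lia.
Qed.

Fact lmulDl : left_distributive lmul ladd.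
Proof.
move=> X Y Z; apply: laurent_ext => n /=.
have [a [Xa Ya]] := common_bound (laurentP X) (laurentP Y).
have [b Zb] := laurentP Z.
have XYa : vanish_below (ladd X Y) a by move=> i ia /=; rewrite Xa// Ya// addr0.
have nm : n - a - b < `|(n - a - b)%R|.+1%:Z by lia.
rewrite (cauchy_prodE XYa Zb nm) (cauchy_prodE Xa Zb nm) (cauchy_prodE Ya Zb nm).
by rewrite -big_split; apply: eq_bigr => i _ /=; rewrite mulrDl.
Qed.

Fact laddA : associative ladd.
Proof. by move=> X Y Z; apply: laurent_ext => n /=; rewrite addrA. Qed.
Fact laddC : commutative ladd.
Proof. by move=> X Y; apply: laurent_ext => n /=; rewrite addrC. Qed.
Fact ladd0 : left_id lzero ladd.
Proof. by move=> X; apply: laurent_ext => n /=; rewrite add0r. Qed.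
Fact laddN : left_inverse lzero lopp ladd.
Proof. by move=> X; apply: laurent_ext => n /=; rewrite addNr. Qed.

HB.instance Definition _ :=
  GRing.isZmodule.Build (laurent k) laddA laddC ladd0 laddN.

Fact lone_neq0 : lmonom 0 != 0 :> laurent k.
Proof.
by apply/eqP => /(congr1 (fun X => lcoef X 0))/eqP /=; rewrite oner_eq0.
Qed.

HB.instance Definition _ := GRing.Zmodule_isComNzRing.Build (laurent k)
  lmulA lmulC lmul1 lmulDl lone_neq0.

Lemma laurent_lead X : X != 0 -> exists a, X a != 0 /\ vanish_below X a.
Proof.
move=> X0; have [a Xa] := laurentP X.
have : exists n : nat, X (a + n%:Z) != 0.
  apply: contrapT => /forallNP h; move/eqP: X0; apply.
  apply: laurent_ext => n /=; have [na|an] := ltP n a; first exact: Xa.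
  have -> : n = a + `|n - a|%N%:Z by lia.
  by apply/eqP/negbNE/negP; exact: h.
case/ex_minnP => n Xn nmin; exists (a + n%:Z); split=> // i ian.
have [ia|ai] := ltP i a; first exact: Xa.
apply/eqP/negbNE/negP => Xi.
have := nmin `|i - a|%N; have -> : a + `|i - a|%N%:Z = i by lia.
by move=> /(_ Xi); lia.
Qed.

(* First n + 1 coefficients of the inverse of the power series with
   coefficients c 0, c 1, ... *)
Fixpoint inv_coefs (c : nat -> k) (n : nat) : seq k :=
  if n is m.+1 then
    let s := inv_coefs c m in
    rcons s (- (c 0%N)^-1 * \sum_(i < m.+1) c i.+1 * s`_(m - i))
  else [:: (c 0%N)^-1].

Let size_inv_coefs c n : size (inv_coefs c n) = n.+1.
Proof. by elim: n => //= n IH; rewrite size_rcons IH. Qed.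

Let nth_inv_coefs c m n : (m <= n)%N ->
  (inv_coefs c n)`_m = (inv_coefs c m)`_m.
Proof.
elim: n => [|n IH]; first by rewrite leqn0 => /eqP ->.
rewrite leq_eqVlt => /orP[/eqP -> //|mn].
by rewrite /= nth_rcons size_inv_coefs mn IH.
Qed.

Let inv_coefsP (c : nat -> k) n : c 0%N != 0 ->
  \sum_(i < n.+1) c i * (inv_coefs c (n - i))`_(n - i) = (n == 0%N)%:R.
Proof.
move=> c0; case: n => [|n].
  by rewrite big_ord_recl big_ord0 /= addr0 mulfV.
rewrite big_ord_recl /= subn0 nth_rcons size_inv_coefs ltnn eqxx.
rewrite mulrA mulrN mulfV// mulN1r; apply/eqP; rewrite addrC subr_eq0.
apply/eqP/eq_bigr => i _; rewrite /bump /= add1n subSS.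
by rewrite [in RHS]nth_inv_coefs// leq_subr.
Qed.

Lemma laurent_inv_ex X : X != 0 -> exists Y, Y * X = 1.
Proof.
move=> /laurent_lead[a [X0 Xa]].
pose c n := X (a + n%:Z); have c0 : c 0%N != 0 by rewrite /c addr0.
pose y (n : int) : k :=
  if n < - a then 0 else (inv_coefs c `|(n + a)%R|%N)`_`|(n + a)%R|%N.
have ya : vanish_below y (- a) by move=> i ia; rewrite /y ia.
exists (Laurent (ex_intro _ _ ya)); rewrite mulrC; apply: laurent_ext => n.
rewrite /= -/(cauchy_prod _ _ _).
have [n0|n0] := ltP n 0.
  rewrite (cauchy_prod_vanish Xa ya); last by lia.
  by rewrite [_ == _](_ : _ = false)//; lia.
rewrite (cauchy_prodE (m := `|n|.+1) Xa ya); last by lia.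
have -> : (n == 0) = (`|n|%N == 0%N) by lia.
rewrite -(inv_coefsP _ c0); apply: eq_bigr => i _; congr (_ * _).
have ni := ltn_ord i; rewrite /y ifF; last by lia.
by have -> : `|(n - a - i%:Z + a)%R|%N = (`|n| - i)%N by lia.
Qed.

Definition linv X : laurent k := xget 0 [set Y | X != 0 /\ Y * X = 1].

Fact lmulV X : X != 0 -> linv X * X = 1.
Proof.
move=> X0; have [Y YX] := laurent_inv_ex X0.
rewrite /linv; set P := (X in xget 0 X).
by have [] : P (xget 0 P) by apply: xgetPex; exists Y.
Qed.

Fact linv0 : linv 0 = 0.
Proof. by rewrite /linv; case: xgetP => //= Y _ []; rewrite eqxx. Qed.

HB.instance Definition _ := GRing.ComNzRing_isField.Build (laurent k)
  lmulV linv0.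

(* The value at 0 is the default 0 of xget. *)
Definition degtV X : int :=
  xget 0 [set n : int | X (- n) != 0 /\ forall m, X (- m) != 0 -> m <= n].

Lemma degtVP X : X != 0 ->
  X (- degtV X) != 0 /\ forall m, X (- m) != 0 -> m <= degtV X.
Proof.
move=> /laurent_lead[a [X0 Xa]]; rewrite /degtV.
set P := (P in xget 0 P).
suff : P (xget 0 P) by [].
apply: xgetPex; exists (- a); split=> [|m]; first by rewrite opprK.
by move=> Xm; rewrite leNgt; apply: contra Xm => am; apply/eqP/Xa; lia.
Qed.

Lemma degtV0 : degtV 0 = 0.
Proof. by rewrite /degtV; case: xgetP => // n _ [] /=; rewrite eqxx. Qed.

Definition tval X : int := - degtV X.

End LaurentField.

(* Normalized discrete valuation. Its value +oo at 0 is encoded as 0; use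
   val_ge below rather than comparing values directly. *)
Definition normalized_valuation (E : fieldType) (w : E -> int) : Prop :=
  [/\ w 0 = 0,
      forall x y, x != 0 -> y != 0 -> w (x * y) = w x + w y,
      forall x y, x != 0 -> y != 0 -> x + y != 0 ->
        Num.min (w x) (w y) <= w (x + y)
    & exists2 x, x != 0 & w x = 1].

Definition val_ge (E : fieldType) (w : E -> int) (n : int) (x : E) : bool :=
  (x == 0) || (n <= w x).

Section Ramification.
Variables (k : fieldType) (L : splittingFieldType (laurent k)).

(* The normalized valuation of L above that of k((t)); it exists and is unique
   because k((t)) is complete. *)
Definition valL : L -> int :=
  xget (fun=> 0) [set w : L -> int | normalized_valuation w /\
    exists2 e : nat, (0 < e)%N &
      forall X : laurent k, X != 0 -> w X%:A = e%:Z * tval X].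

Definition ramification_index : int := valL (lmonom k 1)%:A.

Definition totally_ramified : Prop := ramification_index = (\dim {:L})%:Z.

Variable R : realType.
Implicit Types u nu : R.

(* Gamma_u, with Gamma_u = Gamma_i for i the least integer >= u. *)
Definition lower_group u : {set gal_of {:L}} :=
  [set s in 'Gal({:L} / 1%AS)%g | `[< forall x : L,
     val_ge valL 0 x -> val_ge valL (Num.ceil u + 1) (s x - x) >]]%SET.

(* phi(u) = \int_0^u dt / (Gamma_0 : Gamma_t). On [-1, 0] the integrand is 1
   (up to the point -1); for m <= u <= m + 1 with m a natural number, the
   integral is (g_1 + ... + g_m + (u - m) g_(m+1)) / g_0, g_i = #|Gamma_i|. *)
Definition herbrand_phi u : R :=
  if u <= 0 then u else
  let g (i : nat) : R := #|lower_group i%:R|%:R in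
  let m := Num.truncn u in
  (\sum_(1 <= i < m.+1) g i + (u - m%:R) * g m.+1) / g 0%N.

(* inverse of the bijection herbrand_phi : [-1, +oo[ -> [-1, +oo[ *)
Definition herbrand_psi nu : R :=
  xget 0 [set u : R | -1 <= u /\ herbrand_phi u = nu]%classic.

Definition upper_group nu : {set gal_of {:L}} :=
  lower_group (herbrand_psi nu).

Definition is_max (A : set R) nu : Prop := A nu /\ ubound A nu.

(* nu is the i-th break of the filtration Gr of a group of order 2 ^ n *)
Definition is_break (Gr : R -> {set gal_of {:L}}) (i : nat) nu : Prop :=
  let n := logn 2 #|'Gal({:L} / 1%AS)%g| in
  is_max [set mu : R | -1 <= mu /\ (2 ^ (n + 1 - i) <= #|Gr mu|)%N]%classic nu.

Definition lower_break := is_break lower_group.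
Definition upper_break := is_break upper_group.

End Ramification.

Arguments lower_break {k} L {R}.
Arguments upper_break {k} L {R}.

Definition pos_odd (n : int) : Prop := 0 < n /\ ~~ (2 %| n)%Z.
Definition pos_even (n : int) : Prop := 0 < n /\ (2 %| n)%Z.

(* Main.v *)
(* Let w be the normalized valuation of L. Total ramification makes the powers
   of any x with w(x) odd a K-basis of L, whence the residue field of L is k,
   w is Galois invariant, and w(rho x - x) - w(x) decides in which lower
   ramification groups rho lies. An x with w(x) odd is found in two biquadratic
   Artin-Schreier steps, K(q, s) over K and then L over K(q): among the
   translates of a generator by a submodule pick one of maximal valuation; as k
   is the residue field, this valuation is not attained in the submodule, and
   comparing parities in the Artin-Schreier equation of the translate determines
   it. No perfectness of k is needed, since leading coefficients are matched
   inside L. The element x satisfies x^2 + x = C + D v with C, D in K(q) and v in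
   K(q, s), so rho x - x is governed by rho v - v. Finally the eight elements of
   Gal(L/K) are told apart by their action on q, s and r, which gives the orders
   of the lower groups, and the Herbrand function is a combination of the
   truncations min(u, l_i). *)

Require Import Defs.
From mathcomp Require Import all_boot all_order all_fingroup all_algebra.
From mathcomp Require Import all_solvable all_field.
From mathcomp Require Import boolp classical_sets reals.
From mathcomp Require Import zify ring lra.

Set Implicit Arguments.
Unset Strict Implicit.
Unset Printing Implicit Defensive.

Import Order.TTheory GRing.Theory Num.Theory.

Local Open Scope ring_scope.

(** * Normalized valuations and Artin-Schreier expressions *)

Section Valuation.
Variables (E : fieldType) (w : E -> int).
Hypothesis w_val : normalized_valuation w.
Implicit Types (x y z : E) (m n : int).

(** Nonvanishing is included because [w 0 = 0] is only an encoding of an infinite value. *)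
Definition hasval n x : bool := (x != 0) && (w x == n).

Lemma valM x y : x != 0 -> y != 0 -> w (x * y) = w x + w y.
Proof. by case: w_val => _ h _ _; exact: h. Qed.

Lemma val1 : w 1 = 0.
Proof.
have := valM (oner_neq0 E) (oner_neq0 E).
by rewrite mulr1 -[LHS]addr0 => /addrI. Qed.

Lemma valN x : w (- x) = w x.
Proof.
have [->|x0] := eqVneq x 0; first by rewrite oppr0.
have N0 : (- 1 : E) != 0 by rewrite oppr_eq0 oner_eq0.
have := valM N0 N0; rewrite mulrNN mulr1 val1 => hN.
by rewrite -mulN1r valM//; lia.
Qed.

Lemma hasval_val x : x != 0 -> hasval (w x) x.
Proof. by rewrite /hasval eqxx => ->. Qed.

Lemma hasval1 : hasval 0 1.
Proof. by rewrite /hasval oner_eq0 val1. Qed.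

Lemma hasvalM {m n x y} : hasval m x -> hasval n y -> hasval (m + n) (x * y).
Proof.
move=> /andP[x0 /eqP wx] /andP[y0 /eqP wy].
by rewrite /hasval mulf_neq0//= valM// wx wy.
Qed.

Lemma hasvalX {n x} i : hasval n x -> hasval (i%:Z * n) (x ^+ i).
Proof.
move=> hx; elim: i => [|i IH]; first by rewrite mul0r hasval1.
by rewrite exprS; have := hasvalM hx IH; congr hasval; lia.
Qed.

Lemma hasvalV {n x} : hasval n x -> hasval (- n) x^-1.
Proof.
move=> /andP[x0 /eqP wx]; rewrite /hasval invr_eq0 x0 /=.
have := @valM x x^-1 x0; rewrite invr_eq0 mulfV// val1 => /(_ x0).
by lia.
Qed.

Lemma hasval_uniq {m n x} : hasval m x -> hasval n x -> m = n.
Proof. by move=> /andP[_ /eqP <-] /andP[_ /eqP <-]. Qed.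

Lemma hasval_ge {m n x} : hasval n x -> m <= n -> val_ge w m x.
Proof. by rewrite /val_ge => /andP[_ /eqP ->] ->; rewrite orbT. Qed.

Lemma val_ge_le {m n x} : val_ge w m x -> hasval n x -> m <= n.
Proof.
rewrite /val_ge => /orP[/eqP->|h] /andP[x0 /eqP <-] //.
by rewrite eqxx in x0.
Qed.

Lemma val_geW {m n x} : m <= n -> val_ge w n x -> val_ge w m x.
Proof. by rewrite /val_ge => mn /orP[->//|h]; rewrite (le_trans mn h) orbT. Qed.

Lemma val_ge0 n : val_ge w n 0.
Proof. by rewrite /val_ge eqxx. Qed.

Lemma val_geN n x : val_ge w n (- x) = val_ge w n x.
Proof. by rewrite /val_ge oppr_eq0 valN. Qed.

Lemma val_geD {n x y} : val_ge w n x -> val_ge w n y -> val_ge w n (x + y).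
Proof.
have [->|x0] := eqVneq x 0; first by rewrite add0r.
have [->|y0] := eqVneq y 0; first by rewrite addr0.
have [->|xy0] := eqVneq (x + y) 0; first by rewrite val_ge0.
rewrite /val_ge (negbTE x0) (negbTE y0) (negbTE xy0) /=.
case: w_val => _ _ /(_ x y x0 y0 xy0) h _ nx ny.
by apply: le_trans h; rewrite le_min nx.
Qed.

Lemma val_geB {n x y} : val_ge w n x -> val_ge w n y -> val_ge w n (x - y).
Proof. by move=> hx hy; apply: val_geD => //; rewrite val_geN. Qed.

Lemma val_geM {m n x y} :
  val_ge w m x -> val_ge w n y -> val_ge w (m + n) (x * y).
Proof.
have [->|x0] := eqVneq x 0; first by move=> *; rewrite mul0r val_ge0.
have [->|y0] := eqVneq y 0; first by move=> *; rewrite mulr0 val_ge0.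
rewrite /val_ge mulf_eq0 (negbTE x0) (negbTE y0) /=.
by rewrite valM//; lia.
Qed.

Lemma val_geX {n x} i : val_ge w n x -> val_ge w (i%:Z * n) (x ^+ i).
Proof.
move=> hx; elim: i => [|i IH]; first by apply: hasval_ge hasval1 _; lia.
by rewrite exprS; have := val_geM hx IH; congr val_ge; lia.
Qed.

Lemma val_ge_sum n (I : Type) (r : seq I) (P : pred I) (F : I -> E) :
  (forall i, P i -> val_ge w n (F i)) -> val_ge w n (\sum_(i <- r | P i) F i).
Proof.
move=> h; elim/big_ind: _ => //; first exact: val_ge0.
by move=> x y; exact: val_geD.
Qed.

Lemma val_geVhas n x :
  val_ge w n x \/ exists m, m < n /\ hasval m x.
Proof.
rewrite /val_ge; have [x0|x0] := eqVneq x 0; first by left.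
have [h|h] := lerP n (w x); first by left.
by right; exists (w x); split=> //; exact: hasval_val.
Qed.

Lemma hasvalDl {m n x y} : hasval n x -> val_ge w m y -> n < m ->
  hasval n (x + y).
Proof.
move=> hx gy nm; have gx := hasval_ge hx (lexx n).
have gs : val_ge w n (x + y) by apply: val_geD => //; apply: val_geW gy; lia.
have [s1|[j [jn sj]]] := val_geVhas (n + 1) (x + y); last first.
  by have := val_ge_le gs sj => nj; have <- : j = n by lia.
have : val_ge w (n + 1) (x + y - y).
  by apply: val_geB => //; apply: val_geW gy; lia.
by rewrite addrK => /val_ge_le/(_ hx); lia.
Qed.

Lemma hasvalDr {m n x y} : val_ge w m x -> hasval n y -> n < m ->
  hasval n (x + y).
Proof. by move=> gx hy nm; rewrite addrC; exact: hasvalDl gx nm. Qed.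

Lemma hasvalAS {n x} : hasval n x -> n < 0 -> hasval (2 * n) (x ^+ 2 + x).
Proof.
by move=> hx n0; apply: hasvalDl (hasvalX 2 hx) (hasval_ge hx (lexx _)) _; lia.
Qed.

Lemma val_geAS {x} : val_ge w 0 x -> val_ge w 0 (x ^+ 2 + x).
Proof. by move=> hx; apply: val_geD => //; exact: (val_geX 2 hx). Qed.

(** An integral [x] would make [x^2 + x] integral, so [w x] is negative and the square dominates. *)
Lemma hasvalASV {n x} : hasval n (x ^+ 2 + x) -> n < 0 ->
  exists2 m, n = 2 * m & hasval m x.
Proof.
move=> hn n0; have [/val_geAS/val_ge_le/(_ hn)|[m [m0 xm]]] := val_geVhas 0 x.
  by lia.
by exists m => //; have := hasval_uniq hn (hasvalAS xm m0).
Qed.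

(** A negative valuation of [y^2 + y] equals [2 * w y], which differs from [n], so the leading term
    of [x] cannot be cancelled. *)
Lemma hasval_oddDAS n x y : hasval n x -> n < 0 -> (y != 0 -> 2 * w y <> n) ->
  exists2 n', n' <= n & hasval n' (x + (y ^+ 2 + y)).
Proof.
move=> xn n0 y2; have [/val_geAS g|[m [m0 ym]]] := val_geVhas 0 y.
  by exists n => //; exact: hasvalDl g n0.
have y0 : y != 0 by case/andP: ym.
have {y2} : 2 * m <> n by case/andP: ym => y0' /eqP <-; exact: y2.
have hAS := hasvalAS ym m0; have [nm|mn] := ltP n (2 * m) => ne.
  by exists n => //; exact: hasvalDl xn (hasval_ge hAS (lexx _)) nm.
exists (2 * m) => //; apply: hasvalDr (hasval_ge xn (lexx _)) hAS _; lia.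
Qed.

(* S is the base of a biquadratic extension generated by p1 and p2. As 2 w(x)
   is not attained on S, the leading term of x^2 + x is (A^2 + A) p1, which
   forces the leading terms of P2 and A^2 P1 to cancel. *)
Lemma biquadratic_break (two0 : 2 = 0 :> E) (S : E -> Prop) (N b1 b2 n : int)
    (p1 p2 P1 P2 A B x : E) :
  N = 4 \/ N = 8 ->
  (forall y z, S y -> S z -> S (y + z)) ->
  (forall y z, S y -> S z -> S (y * z)) ->
  (forall y, S y -> y != 0 -> exists i, w y = N * i) ->
  p1 ^+ 2 = p1 + P1 -> p2 ^+ 2 = p2 + P2 ->
  S P1 -> S P2 -> S A -> S B ->
  hasval (- (N * b1)) P1 -> 0 < b1 -> ~~ (2 %| b1)%Z ->
  hasval (- (N * b2)) P2 -> 0 < b2 -> ~~ (2 %| b2)%Z ->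
  x = p2 + A * p1 + B -> hasval n x -> n < 0 -> (forall i, 2 * n <> N * i) ->
  exists a C, [/\ hasval a A, 2%:Z * a = N * (b1 - b2),
    x ^+ 2 + x = C + (A ^+ 2 + A) * p1,
    S C /\ val_ge w (2 * n + 1) C & hasval (2 * n) ((A ^+ 2 + A) * p1)].
Proof.
move=> hN SD SM SN e1 e2 SP1 SP2 SA SB hP1 b1_gt0 b1_odd hP2 b2_gt0 b2_odd.
move=> xE hx n0 n_odd.
have K1 : 0 < N * b1 by clear -hN b1_gt0; case: hN => ->; lia.
have K2 : 0 < N * b2 by clear -hN b2_gt0; case: hN => ->; lia.
(* In this form oddness says that half of [N * b1] is not a valuation attained on [S]; likewise for
   [b2]. *)
have K1N i : N * b1 <> 2 * (N * i) by clear -hN b1_odd; case: hN => ->; lia.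
have K2N i : N * b2 <> 2 * (N * i) by clear -hN b2_odd; case: hN => ->; lia.
rewrite mulrBr; move: (N * b1) (N * b2) => k1 k2 in hP1 hP2 K1 K2 K1N K2N *.
clear b1 b2 b1_gt0 b1_odd b2_gt0 b2_odd hN.
have [||c cE hp1] := @hasvalASV (- k1) p1.
- by rewrite e1 (_ : _ + _ + _ = P1)//; ring: two0.
- by clear -K1; lia.
pose C := P2 + A ^+ 2 * P1 + (B ^+ 2 + B); pose D := A ^+ 2 + A.
have WE : x ^+ 2 + x = C + D * p1 by rewrite xE /C /D; ring: two0 e1 e2.
have hW : hasval (2 * n) (C + D * p1) by rewrite -WE; exact: hasvalAS.
have SC : S C by apply: (SD); [apply: (SD) => //; apply: (SM) => //; apply: SM
  | apply: (SD) => //; apply: SM].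
have SDD : S D by apply: SD => //; apply: SM.
have D0 : D != 0.
  apply/eqP => D0; move: hW; rewrite D0 mul0r addr0 => /andP[C0 /eqP wC].
  by have [i wi] := SN C SC C0; apply: (n_odd i); rewrite -wC.
have [i wD] := SN D SDD D0.
have hDp := hasvalM (hasval_val D0) hp1.
(* [w C] is a multiple of [N], while [2 * n] and [w (D * p1)] are not; hence nothing cancels and
   [D * p1] carries the valuation [2 * n]. *)
have [gC hDn] : val_ge w (2 * n + 1) C /\ hasval (2 * n) (D * p1).
  have [gC|[m [mn hC]]] := val_geVhas (2 * n + 1) C.
    split=> //; have -> : D * p1 = C + D * p1 - C by rewrite addrC addKr.
    by apply: hasvalDl hW _ (_ : _ < 2 * n + 1); [rewrite val_geN|clear; lia].
  have /andP[C0 /eqP wC] := hC.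
  have [j wj] := SN C SC C0.
  have mm : m <> 2 * n by move=> m2; apply: (n_odd j); rewrite -m2 -wC.
  have [lt|le] := ltP m (w D + c).
    have hm := hasvalDl hC (hasval_ge hDp (lexx _)) lt.
    by case: mm; exact: hasval_uniq hm hW.
  have lt : w D + c < m.
    rewrite lt_neqAle le andbT; apply/eqP => eqm; apply: (K1N (i - j)).
    by move: eqm cE wC; rewrite wD wj mulrBr; clear; lia.
  have := hasval_uniq hW (hasvalDr (hasval_ge hC (lexx _)) hDp lt).
  by clear -lt mn mm; lia.
have wDn := hasval_uniq hDp hDn.
have A0 : A != 0 by apply: contraNneq D0 => A0; rewrite /D A0 expr0n addr0.
have hA := hasval_val A0; have [a wA] := SN A SA A0.
have hA2P : hasval (2 * w A - k1) (A ^+ 2 * P1).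
  exact: hasvalM (hasvalX 2 hA) hP1.
have wDE : [\/ w A = 0 /\ 0 <= w D, 0 < w A /\ w D = w A
    | w A < 0 /\ w D = 2 * w A].
  have [a0|a0|a0] := ltgtP (w A) 0; last first.
  - apply: Or31; split=> //; apply: val_ge_le (hasval_val D0).
    by apply: val_geAS; by apply: hasval_ge hA _; rewrite a0.
  - apply: Or32; split=> //.
    have : hasval (w A) D.
      apply: hasvalDr (hasval_ge (hasvalX 2 hA) (lexx _)) hA _.
      by clear -a0; lia.
    by case/andP => _ /eqP.
  - by apply: Or33; split=> //; have /andP[_ /eqP] := hasvalAS hA a0.
(* If [P2] and [A^2 * P1] had different valuations, the smaller one would survive the addition of
   [B^2 + B] and bound [w C] from above. Since [w C > 2 * n = w D + c], each of the three cases for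
   [w D] is then contradictory. *)
exists (w A), C; split=> //; apply: contrapT => ne.
have oddC m : hasval m (P2 + A ^+ 2 * P1) -> m < 0 ->
    (forall i, m <> 2 * (N * i)) -> 2 * n + 1 <= m.
  move=> hm m0 mN; have [|m' mm hm'] := hasval_oddDAS hm m0 (y := B).
    by move=> /(SN B SB)[j ->]; exact/nesym/mN.
  by have := val_ge_le gC hm'; clear -mm; lia.
have [lt|le] := ltP (- k2) (2 * w A - k1).
  have := oddC _ (hasvalDl hP2 (hasval_ge hA2P (lexx _)) lt) _ _.
  have k20 : - k2 < 0 by clear -K2; lia.
  have k2N j : - k2 <> 2 * (N * j).
    by move=> kj; apply: (K2N (- j)); rewrite mulrN; clear -kj; lia.
  move=> /(_ k20 k2N); clear -lt wDn wDE cE K1 K2 ne; case: wDE => -[]; lia.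
have lt : 2 * w A - k1 < - k2 by clear -le ne; lia.
have := oddC _ (hasvalDr (hasval_ge hP2 (lexx _)) hA2P lt) _ _.
have k0 : 2 * w A - k1 < 0 by clear -lt K2; lia.
have kN j : 2 * w A - k1 <> 2 * (N * j).
  move=> kj; apply: (K1N (a - j)).
  by rewrite mulrBr; move: kj; rewrite wA; clear; lia.
move=> /(_ k0 kN); clear -lt wDn wDE cE K1 K2 ne; case: wDE => -[]; lia.
Qed.

End Valuation.

(** The nonzero terms have distinct valuations, so a single term is the smallest and decides the
    sum. *)
Lemma hasval_sum (E : fieldType) (w : E -> int) (I : finType) (F : I -> E) i0 :
  normalized_valuation w ->
  (forall i j, F i != 0 -> F j != 0 -> w (F i) = w (F j) -> i = j) ->
  F i0 != 0 ->
  exists i, hasval w (w (F i)) (\sum_j F j) /\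
    forall j, val_ge w (w (F i)) (F j).
Proof.
move=> wv wF Fi0.
have [i Fi imin] :=
  @arg_minP _ _ _ i0 (fun i => F i != 0) (fun i => w (F i)) Fi0.
exists i; split=> [|j]; last first.
  by rewrite /val_ge; have [//|Fj] := eqVneq (F j) 0; exact: imin.
rewrite (bigD1 i)//=.
apply: (hasvalDl wv (m := w (F i) + 1)); [exact: hasval_val| |lia].
apply: val_ge_sum => // j ji; rewrite /val_ge.
have [//|Fj] := eqVneq (F j) 0; have := imin j Fj.
have : w (F j) <> w (F i) by move/(wF _ _ Fj Fi)/eqP; rewrite (negbTE ji).
by move=> ne le; apply/orP; right; move: ne le; clear; lia.
Qed.

Lemma tval_lmonom (k : fieldType) n : Defs.tval (lmonom k n) = n.
Proof.
have n0 : lmonom k n != 0.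
  by apply/eqP => /(congr1 (fun X => lcoef X n))/eqP; rewrite /= eqxx oner_eq0.
have [] := degtVP n0; rewrite /Defs.tval /=.
by case: (_ =P n) => [->//|_]; rewrite eqxx.
Qed.

Lemma lmonom_neq0 (k : fieldType) n : lmonom k n != 0.
Proof.
by apply/eqP => /(congr1 (fun X => lcoef X n))/eqP; rewrite /= eqxx oner_eq0.
Qed.

(** * Power bases, the residue field and Galois invariance *)

Section TotallyRamified.
Variables (k : fieldType) (L : splittingFieldType (laurent k)).
Variables (w : L -> int) (e : nat).
Hypotheses (w_val : normalized_valuation w) (dimL : \dim {:L} = e).
Hypothesis w_base : forall X : laurent k, X != 0 -> w X%:A = e%:Z * Defs.tval X.
Implicit Types (c X : laurent k) (x y z : L) (s : gal_of {:L}).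

Local Notation hasval := (hasval w).
Local Notation val_ge := (val_ge w).

Lemma e_gt0 : (0 < e)%N.
Proof. by rewrite -dimL adim_gt0. Qed.

Lemma hasval_base X : X != 0 -> hasval (e%:Z * Defs.tval X) X%:A.
Proof.
move=> X0; rewrite /hasval w_base// eqxx andbT.
by rewrite scaler_eq0 (negbTE X0) oner_eq0.
Qed.

Lemma hasval_lmonom n : hasval (e%:Z * n) (lmonom k n)%:A.
Proof. by have := hasval_base (lmonom_neq0 k n); rewrite tval_lmonom. Qed.

Lemma hasvalZ {c x m} : c != 0 -> hasval m x ->
  hasval (e%:Z * Defs.tval c + m) (c *: x).
Proof.
move=> c0 hx; rewrite -mulr_algl.
by apply: hasvalM hx => //; exact: hasval_base.
Qed.

(** The nonzero terms have valuations congruent to [i * w x] modulo [e], distinct by coprimality, so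
    they cannot cancel. The second conclusion serves to prove the powers of [x] independent. *)
Lemma power_sum_val x (c : 'I_e -> laurent k) y :
  coprimez (w x) e%:Z -> x != 0 -> y = \sum_i c i *: x ^+ i ->
  forall i, val_ge (w y) (c i *: x ^+ i) /\ (c i != 0 -> y != 0).
Proof.
move=> cop x0 yE i.
have [c0|ci] := eqVneq (c i) 0; first by rewrite c0 scale0r val_ge0.
have hx i' := hasvalX w_val i' (hasval_val w x0).
have nz (j : 'I_e) : c j *: x ^+ j != 0 -> c j != 0.
  by rewrite scaler_eq0 negb_or => /andP[].
have [||i0 [hs hi]] :=
  @hasval_sum L w _ (fun j : 'I_e => c j *: x ^+ j) i w_val.
- move=> a b /nz ca /nz cb.
  have /andP[_ /eqP ->] := hasvalZ ca (hx a).
  have /andP[_ /eqP ->] := hasvalZ cb (hx b).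
  move=> ab; apply/val_inj.
  have : (e%:Z %| (a%:Z - b%:Z) * w x)%Z.
    apply/dvdzP; exists (Defs.tval (c b) - Defs.tval (c a)).
    by move: ab; clear; lia.
  rewrite Gauss_dvdzl; last by rewrite coprimez_sym.
  have := ltn_ord a; have := ltn_ord b; clear.
  move=> be ae /dvdzP[m mE].
  have m0 : m = 0 by nia.
  by move: mE; rewrite m0 mul0r /=; lia.
- by rewrite scaler_eq0 (negbTE ci) expf_neq0.
- by rewrite yE; have /andP[y0 /eqP ->] := hs.
Qed.

Lemma power_expansion x y : coprimez (w x) e%:Z -> x != 0 ->
  exists c : 'I_e -> laurent k, y = \sum_i c i *: x ^+ i.
Proof.
move=> cop x0; pose X := [tuple x ^+ i | i < e].
have Xi (i : 'I_e) : X`_i = x ^+ i.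
  by rewrite -tnth_nth tnth_mktuple.
have freeX : free X.
  apply/freeP => c c0 i; apply/eqP/negbNE/negP => ci.
  have := power_sum_val (c := c) (y := 0) cop x0 _ i.
  rewrite eqxx => h; have [|_ /(_ ci)//] := h.
  by rewrite -[LHS]c0; apply: eq_bigr => j _; rewrite Xi.
have bX : basis_of {:L} X by rewrite basisEfree freeX subvf size_tuple dimL /=.
exists (fun i => coord X i y); rewrite {1}(coord_basis bX (memvf y)).
by apply: eq_bigr => i _; rewrite Xi.
Qed.

Lemma uniformizer : exists2 p, p != 0 & w p = 1.
Proof. by case: w_val. Qed.

(** The residue field is k. Expand the unit [x / y] in powers of a uniformizer: terms with
    [0 < i < e] have a nonnegative valuation not divisible by [e], hence a positive one, and [c] is
    the constant coefficient. *)
Lemma residue_base x y : x != 0 -> y != 0 -> w x = w y ->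
  exists c, val_ge (w x + 1) (x - c *: y).
Proof.
move=> x0 y0 wxy; have [p p0 wp] := uniformizer.
have cop : coprimez (w p) e%:Z by rewrite wp /coprimez gcd1z.
have hu : hasval 0 (x / y).
  have := hasvalM w_val (hasval_val w x0) (hasvalV w_val (hasval_val w y0)).
  by rewrite wxy subrr.
have [c uE] := power_expansion (x / y) cop p0.
have h := power_sum_val cop p0 uE; have [/eqP u0 /eqP wu] := andP hu.
have e0 := e_gt0; exists (c (Ordinal e0)).
have : val_ge 1 (x / y - (c (Ordinal e0))%:A).
  rewrite {1}uE (bigD1 (Ordinal e0))//= expr0 addrAC subrr add0r.
  apply: val_ge_sum => // i i0; have [hi _] := h i; rewrite wu in hi.
  have [ci|ci] := eqVneq (c i) 0; first by rewrite ci scale0r val_ge0.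
  have hci := hasvalZ ci (hasvalX w_val i (hasval_val w p0)).
  have le := val_ge_le hi hci; apply: hasval_ge hci _; move: le.
  rewrite wp; have := ltn_ord i.
  have : (0 < i)%N.
    by rewrite lt0n; apply: contra i0 => /eqP i0; apply/eqP/val_inj.
  move: (Defs.tval _) (nat_of_ord i) => m j; clear; have [|] := leP 0 m; nia.
move=> /(val_geM w_val)/(_ (hasval_ge (hasval_val w y0) (lexx _))).
by rewrite mulrBl mulfVK// mulr_algl -wxy addrC.
Qed.

(** Expansion in powers of a uniformizer bounds [w (s y)] below by one constant [B] for all integral
    [y]. A negative [w (s x)] would break this bound at a high power of [x]. *)
Lemma gal_val_ge0 s x : val_ge 0 x -> val_ge 0 (s x).
Proof.
have [p p0 wp] := uniformizer.
have cop : coprimez (w p) e%:Z by rewrite wp /coprimez gcd1z.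
pose B : int := - (e%:Z * `|w (s p)|).
have sp0 : s p != 0 by rewrite fmorph_eq0.
have bounded y : val_ge 0 y -> val_ge B (s y).
  have [c yE] := power_expansion y cop p0.
  have [->|y0] := eqVneq y 0; first by move=> _; rewrite rmorph0 val_ge0.
  rewrite {1}/val_ge (negbTE y0) /= => wy.
  rewrite yE rmorph_sum; apply: val_ge_sum => // i _.
  have [hi _] := power_sum_val cop p0 yE i.
  have [ci|ci] := eqVneq (c i) 0; first by rewrite ci scale0r rmorph0 val_ge0.
  have hci := hasvalZ ci (hasvalX w_val i (hasval_val w p0)).
  have := val_ge_le hi hci => le.
  rewrite /= linearZ /= rmorphXn.
  have hsi := hasvalZ ci (hasvalX w_val i (hasval_val w sp0)).
  apply: hasval_ge hsi _; rewrite /B; move: le wy; rewrite wp.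
  have := ltn_ord i.
  move: (Defs.tval _) (nat_of_ord i) (w (s p)) (w y) => m j v u.
  clear => je le u0; have m0 : 0 <= m by have [|] := leP 0 m; nia.
  by have [|] := leP 0 v; nia.
move=> x_ge0; have [//|[m [m0 sxm]]] := val_geVhas w 0 (s x).
have := val_geX w_val `|B|.+1 x_ge0; rewrite mulr0 => /bounded.
rewrite rmorphXn => /val_ge_le/(_ (hasvalX w_val _ sxm)).
by move: m0; clear; nia.
Qed.

(** The unit [t^(- w x) * x^e] and its inverse both stay integral under [s], which pins down
    [e * w (s x)]. *)
Lemma gal_val s x : w (s x) = w x.
Proof.
have [->|x0] := eqVneq x 0; first by rewrite rmorph0.
have sx0 : s x != 0 by rewrite fmorph_eq0.
pose u := lmonom k (- w x) *: x ^+ e.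
have hu : hasval 0 u.
  have := hasvalZ (lmonom_neq0 k (- w x)) (hasvalX w_val e (hasval_val w x0)).
  by rewrite tval_lmonom mulrN addNr.
have su := gal_val_ge0 s (hasval_ge hu (lexx _)).
have suV : val_ge 0 (s u^-1).
  by apply: gal_val_ge0; apply: hasval_ge (hasvalV w_val hu) _; rewrite oppr0.
have := hasvalZ (lmonom_neq0 k (- w x)) (hasvalX w_val e (hasval_val w sx0)).
rewrite -rmorphXn -linearZ /= -/u => hsu.
have := val_ge_le su hsu; have := hasvalV w_val hsu; rewrite -fmorphV => hsuV.
have := val_ge_le suV hsuV; rewrite tval_lmonom; have := e_gt0; clear; nia.
Qed.

Lemma gal_hasval s n x : hasval n (s x) = hasval n x.
Proof. by rewrite /hasval fmorph_eq0 gal_val. Qed.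

Lemma gal_sub_ge s n x : val_ge n x -> val_ge n (s x - x).
Proof.
move=> hx; apply: val_geB => //.
by move: hx; rewrite /val_ge fmorph_eq0 gal_val.
Qed.

End TotallyRamified.

(** * The tower K, K(q), K(q, s), L and a generator of odd valuation *)

Section DihedralElements.
Variables (k : fieldType) (L : splittingFieldType (laurent k)) (w : L -> int).
Hypotheses (w_val : normalized_valuation w) (dimL : \dim {:L} = 8%N).
Hypothesis w_base : forall X : laurent k, X != 0 -> w X%:A = 8 * Defs.tval X.
Hypothesis two0 : 2 = 0 :> L.
Implicit Types (x y z a b c : L) (rho : gal_of {:L}).

Local Notation hasval := (hasval w).
Local Notation val_ge := (val_ge w).

Let addxx x : x + x = 0.
Proof. by rewrite -mulr2n -mulr_natl two0 mul0r. Qed.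

Let subE x y : x - y = x + y.
Proof. by apply/eqP; rewrite subr_eq -addrA addxx addr0. Qed.

Lemma base_val a : a \in 1%AS -> a != 0 -> exists i, w a = 8 * i.
Proof.
move=> /vlineP[X ->] X0; exists (Defs.tval X); rewrite w_base//.
by apply: contraNneq X0 => ->; rewrite scale0r.
Qed.

Lemma gal_base rho a : a \in 1%AS -> rho a = a.
Proof. by move=> /vlineP[X ->]; rewrite linearZ /= rmorph1. Qed.

(** [rho] moves [x + y] by 1 and preserves valuations, so [w (x + y) <= 0]. If [w (x + y)] equals
    [w z] with [z] in [T], then [residue_base] improves [y] by a multiple of [z]; this cannot go on
    forever. *)
Lemma best_approximation (T : L -> Prop) rho x :
  T 0 -> (forall c y z, c \in 1%AS -> T y -> T z -> T (y + c * z)) ->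
  (forall y, T y -> rho y = y) -> rho x = x + 1 ->
  exists y, [/\ T y, x + y != 0, w (x + y) <= 0
    & forall z, T z -> z != 0 -> w (x + y) <> w z].
Proof.
move=> T0 TD Trho rho_x.
have bound y : T y -> x + y != 0 /\ w (x + y) <= 0.
  move=> Ty; have rho_xy : rho (x + y) - (x + y) = 1.
    by rewrite rmorphD /= rho_x Trho//; ring.
  have xy0 : x + y != 0.
    apply: contra_eqN rho_xy => /eqP ->.
    by rewrite rmorph0 subrr eq_sym oner_eq0.
  split=> //; have := hasval_ge (hasval_val w xy0) (lexx _).
  move=> /(gal_sub_ge w_val dimL w_base rho); rewrite rho_xy => /val_ge_le.
  by apply; exact: hasval1.
apply: contrapT => no_best.
have climb (m : nat) : exists2 y, T y & w x + m%:Z <= w (x + y).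
  elim: m => [|m [y Ty le]]; first by exists 0; rewrite ?addr0.
  have [xy0 xy_le0] := bound y Ty; apply: contrapT => no_next; apply: no_best.
  exists y; split=> // z Tz z0 wz; apply: no_next.
  have [c] := residue_base w_val dimL w_base xy0 z0 wz.
  have cB : - (c%:A : L) \in 1%AS by rewrite rpredN; apply/vlineP; exists c.
  have Tn := TD _ _ _ cB Ty Tz.
  have -> : x + y - c *: z = x + (y + - c%:A * z).
    by rewrite mulNr mulr_algl addrA.
  have [n0 _] := bound _ Tn; rewrite /Defs.val_ge (negbTE n0) /= => lt.
  by exists (y + - c%:A * z) => //; move: le lt; clear; lia.
have [y Ty] := climb `|w x|.+1; have [_] := bound y Ty.
by clear; lia.
Qed.

Variables (F G H q r s : L) (f g h d : int).
Hypotheses (FB : F \in 1%AS) (GB : G \in 1%AS) (HB : H \in 1%AS).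
Hypotheses (qE : q ^+ 2 = q + F) (sE : s ^+ 2 = s + G).
Hypothesis rE : r ^+ 2 = r + (G * q + H).
Hypotheses (f_gt0 : 0 < f) (f_odd : ~~ (2 %| f)%Z).
Hypotheses (g_gt0 : 0 < g) (g_odd : ~~ (2 %| g)%Z).
Hypotheses (d_gt0 : 0 < d) (d_odd : ~~ (2 %| d)%Z).
Hypothesis h_odd : 0 < h -> ~~ (2 %| h)%Z.
Hypothesis le_fg : f <= g.
Hypotheses (valF : hasval (- (8 * f)) F) (valG : hasval (- (8 * g)) G).
Hypothesis valFG : hasval (- (8 * d)) (F + G).
Hypothesis valH : (H = 0 /\ h = 0) \/ hasval (- (8 * h)) H.

Lemma valq : hasval (- (4 * f)) q.
Proof.
have [||m mE hm] := @hasvalASV _ w w_val (- (8 * f)) q.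
- by rewrite qE (_ : _ + _ + _ = F)//; ring: two0.
- by clear -f_gt0; lia.
by have <- : m = - (4 * f) by clear -mE; lia.
Qed.

Definition inKq y := exists a b, [/\ a \in 1%AS, b \in 1%AS & y = a + b * q].

Lemma inKq_base a : a \in 1%AS -> inKq a.
Proof. by move=> aB; exists a, 0; rewrite rpred0 mul0r addr0. Qed.

Lemma inKq_q : inKq q.
Proof. by exists 0, 1; rewrite rpred0 rpred1 mul1r add0r. Qed.

Lemma inKqD y z : inKq y -> inKq z -> inKq (y + z).
Proof.
move=> [a [b [aB bB ->]]] [a' [b' [aB' bB' ->]]].
by exists (a + a'), (b + b'); rewrite !rpredD//; split=> //; ring.
Qed.

Lemma inKqM y z : inKq y -> inKq z -> inKq (y * z).
Proof.
move=> [a [b [aB bB ->]]] [a' [b' [aB' bB' ->]]].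
exists (a * a' + b * b' * F), (a * b' + a' * b + b * b').
by rewrite !(rpredD, rpredM)//; split=> //; ring: qE.
Qed.

Lemma inKq_fixed rho y : rho q = q -> inKq y -> rho y = y.
Proof.
by move=> rq [a [b [aB bB ->]]]; rewrite rmorphD /= rmorphM /= rq !gal_base.
Qed.

(** As [f] is odd, nonzero [a] and [b * q] have valuations 0 and 4 modulo 8, so [n] modulo 8 tells
    which one dominates. *)
Lemma inKq_hasval a b n : a \in 1%AS -> b \in 1%AS -> hasval n (a + b * q) ->
  (exists i, n = 8 * i) /\ val_ge (n + 1) (b * q) \/
  [/\ exists i, n = 8 * i + 4, hasval n (b * q) & val_ge (n + 1) a].
Proof.
move=> aB bB hn.
have [b0|b0] := eqVneq b 0.
  left; rewrite b0 mul0r val_ge0; split=> //; move: hn; rewrite b0 mul0r addr0.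
  by move=> /andP[a0 /eqP <-]; exact: base_val.
have [j wb] := base_val bB b0; have hb := hasval_val w b0.
have hbq := hasvalM w_val hb valq; rewrite wb in hbq.
have bq8 : exists i, 8 * j - 4 * f = 8 * i + 4.
  by exists (j - divz (f + 1) 2); move: f_odd; clear; lia.
have [a0|a0] := eqVneq a 0.
  by right; move: hn; rewrite a0 add0r val_ge0 => /hasval_uniq/(_ hbq) ->.
have [i wa] := base_val aB a0; have ha := hasval_val w a0; rewrite wa in ha.
have [lt|le] := ltP (8 * i) (8 * j - 4 * f).
  have := hasvalDl w_val ha (hasval_ge hbq (lexx _)) lt.
  move=> /(hasval_uniq hn) ->; left; split; first by exists i.
  by apply: hasval_ge hbq _; move: lt; clear; lia.
have lt : 8 * j - 4 * f < 8 * i by move: le f_odd; clear; lia.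
have := hasvalDr w_val (hasval_ge ha (lexx _)) hbq lt.
move=> /(hasval_uniq hn) ->; right; split=> //.
by apply: hasval_ge ha _; move: lt; clear; lia.
Qed.

Lemma inKq_val y : inKq y -> y != 0 -> exists i, w y = 4 * i.
Proof.
move=> [a [b [aB bB yE]]] y0; have hy := hasval_val w y0.
rewrite {2}yE in hy.
case: (inKq_hasval aB bB hy) => [[[i ->] _]|[[i ->] _ _]].
- by exists (2 * i); clear; lia.
- by exists (2 * i + 1); clear; lia.
Qed.

(** The difference is the coefficient [b] of [q] in [y]. Absence of cancellation gives
    [w (b * q) >= w y], and [w q = - 4 * f]. *)
Lemma inKq_gal_sub rho y n : rho q = q + 1 -> inKq y -> val_ge n y ->
  val_ge (n + 4 * f) (rho y - y).
Proof.
move=> rq [a [b [aB bB yE]]] hy.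
have -> : rho y - y = b.
  by rewrite yE rmorphD /= rmorphM /= rq !gal_base//; ring.
have [y0|y0] := eqVneq y 0.
  have [->|b0] := eqVneq b 0; first exact: val_ge0.
  have aE : a = b * q by apply/eqP; rewrite -subr_eq0 subE -yE y0.
  have hbq := hasvalM w_val (hasval_val w b0) valq.
  have : a != 0 by rewrite aE; case/andP: hbq.
  move=> /(base_val aB)[i]; have [j wb] := base_val bB b0.
  rewrite aE; case/andP: hbq => _ /eqP ->; rewrite wb.
  by move: f_odd; clear; lia.
have hy' := hasval_val w y0; rewrite {2}yE in hy'.
have le := val_ge_le hy (hasval_val w y0).
have : val_ge (w y) (b * q).
  case: (inKq_hasval aB bB hy') => [[_ ge]|[_ hbq _]].
    by apply: val_geW ge; clear; lia.
  exact: hasval_ge hbq (lexx _).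
have [->|b0] := eqVneq b 0; first by move=> _; exact: val_ge0.
have hb := hasval_val w b0; move=> /val_ge_le/(_ (hasvalM w_val hb valq)) le'.
by apply: hasval_ge hb _; move: le le'; clear; lia.
Qed.

Let lmonom_base i : (lmonom k i)%:A \in (1%AS : {subfield L}).
Proof. by apply/vlineP; exists (lmonom k i). Qed.

(** Powers of t serve for even [i] and, [f] being odd, their products with [q] for odd [i]. Hence
    best approximations modulo K(q) have valuations not divisible by 4. *)
Lemma inKq_attains i : exists2 y, inKq y & hasval (4 * i) y.
Proof.
have [j [iE|iE]] : exists j, i = 2 * j \/ i = 2 * j - f.
  have [i2|i2] := boolP (2 %| i)%Z.
    by exists (divz i 2); left; move: i2; clear; lia.
  by exists (divz (i + f) 2); right; move: i2 f_odd; clear; lia.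
- exists (lmonom k j)%:A; first exact: inKq_base (lmonom_base j).
  by have := hasval_lmonom w_base j; congr hasval; rewrite iE; clear; lia.
- exists ((lmonom k j)%:A * q).
    exact: inKqM (inKq_base (lmonom_base j)) inKq_q.
  have := hasvalM w_val (hasval_lmonom w_base j) valq.
  by congr hasval; rewrite iE; clear; lia.
Qed.

(** [v] is a best translate of [s] modulo K(q). Both [A] and [A + 1] are measured because they are
    the values of [rho v - v] for [rho] moving [q], with [s] fixed or moved. *)
Lemma exists_reduced_s (tau : gal_of {:L}) : tau q = q -> tau s = s + 1 ->
  exists A B v V vA vA1 n,
  [/\ [/\ A \in 1%AS, B \in 1%AS & v = s + A * q + B],
      v ^+ 2 = v + V /\ inKq V,
      [/\ hasval n v, hasval vA A & hasval vA1 (A + 1)]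
    & [/\ f < g, d = g, vA = 4 * (f - g), vA1 = 4 * (f - g)
        & n = - (2 * (2 * g - f))] \/
      [/\ f = g, d <= f, vA = 0, vA1 = 4 * (f - d) & n = - (2 * d)]].
Proof.
move=> tau_q tau_s.
have [||||y [[B [A [BB AB yE]]] v0 v_le0 v_best]] :=
    @best_approximation inKq tau s.
- by apply: inKq_base; exact: rpred0.
- move=> c y z cB yK zK; apply: inKqD => //.
  by apply: inKqM => //; exact: inKq_base.
- by move=> y; exact: inKq_fixed.
- by [].
have vE : s + y = s + A * q + B by rewrite yE; ring.
set v := s + y in v0 v_le0 v_best vE *; pose n := w v.
have n4 i : n <> 4 * i.
  have [z zK /andP[z0 /eqP <-]] := inKq_attains i; exact: v_best.
have n0 : n < 0 by move: v_le0 (n4 0); rewrite -/n; clear; lia.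
have hv : hasval n v := hasval_val w v0.
pose V := (G + A ^+ 2 * F + B ^+ 2 + B) + (A ^+ 2 + A) * q.
have VK : inKq V.
  by exists (G + A ^+ 2 * F + B ^+ 2 + B), (A ^+ 2 + A);
     rewrite !(rpredD, rpredM, rpredX).
have v2 : v ^+ 2 = v + V by rewrite vE /V; ring: two0 qE sE.
have hV : hasval (2 * n) V.
  by have := hasvalAS w_val hv n0; rewrite v2 addrAC addxx add0r.
have n8 i : 2 * n <> 8 * i by move: (n4 i); clear; lia.
have base_D y1 z1 : y1 \in 1%AS -> z1 \in 1%AS ->
    y1 + z1 \in (1%AS : {subfield L}).
  exact: rpredD.
have base_M y1 z1 : y1 \in 1%AS -> z1 \in 1%AS ->
    y1 * z1 \in (1%AS : {subfield L}).
  exact: rpredM.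
(* A second look at the same [v]: with [s + q] in place of [s], the coefficient of [q] is [A + 1]
   and [F + G] replaces [G]. *)
have hsq : (s + q) ^+ 2 = s + q + (F + G) by ring: two0 qE sE.
have vE' : v = (s + q) + (A + 1) * q + B by rewrite vE; ring: two0.
have AB1 : A + 1 \in (1%AS : {subfield L}) by rewrite rpredD ?rpred1.
have FGB : F + G \in (1%AS : {subfield L}) by rewrite rpredD.
have [a [C [hA aE _ _ hDq]]] := biquadratic_break w_val two0 (or_intror erefl)
  base_D base_M base_val qE sE FB GB AB BB valF f_gt0 f_odd valG g_gt0 g_odd
  vE hv n0 n8.
have [a1 [C1 [hA1 a1E _ _ _]]] := biquadratic_break w_val two0
  (or_intror erefl) base_D base_M base_val qE hsq FB FGB AB1 BB valF f_gt0
  f_odd valFG d_gt0 d_odd vE' hv n0 n8.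
exists A, B, v, V, a, a1, n; split=> //.
(* This product has valuation [2 * n], so the two coefficient valuations determine [n]. *)
have AA1 : (A ^+ 2 + A) * q = A * (A + 1) * q by ring.
have := hasvalM w_val (hasvalM w_val hA hA1) valq; rewrite -AA1.
move=> /(hasval_uniq hDq) nE.
have [ltfg|gtfg|eqfg] := ltgtP f g; last first.
- right; have dle : d <= f.
    have gG : val_ge (- (8 * f)) G by apply: hasval_ge valG _; rewrite eqfg.
    have := val_ge_le (val_geD w_val (hasval_ge valF (lexx _)) gG) valFG.
    by clear; lia.
  by split=> //; move: nE aE a1E eqfg; clear; lia.
- by move: le_fg gtfg; clear; lia.
have dg : d = g.
  have lt : - (8 * g) < - (8 * f) by move: ltfg; clear; lia.
  have := hasvalDr w_val (hasval_ge valF (lexx _)) valG lt.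
  by move=> /(hasval_uniq valFG); clear; lia.
by left; split=> //; move: nE aE a1E dg; clear; lia.
Qed.

(** [p] is a best translate of [r] modulo K(q). As [w P] is not a multiple of 8, the [q]-part of [P]
    dominates; comparing it with the K-part yields [b = 2 * max(f + g, h) - f]. *)
Lemma exists_reduced_r (z : gal_of {:L}) : z q = q -> z r = r + 1 ->
  exists y p P (b : int),
  [/\ inKq y /\ p = r + y, p ^+ 2 = p + P /\ inKq P,
      hasval (- (4 * b)) P
    & b = 2 * g + f /\ h <= f + g \/ b = 2 * h - f /\ f + g <= h].
Proof.
move=> z_q z_r.
have [||||y [yK p0 p_le0 p_best]] := @best_approximation inKq z r.
- by apply: inKq_base; exact: rpred0.
- move=> c y x cB yK xK; apply: inKqD => //.
  by apply: inKqM => //; exact: inKq_base.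
- by move=> y; exact: inKq_fixed.
- by [].
have [y0 [y1 [y0B y1B yE]]] := yK.
set p := r + y in p0 p_le0 p_best *; pose n := w p.
have n4 i : n <> 4 * i.
  have [x xK /andP[x0 /eqP <-]] := inKq_attains i; exact: p_best.
have n0 : n < 0 by move: p_le0 (n4 0); rewrite -/n; clear; lia.
pose c0 := H + y1 ^+ 2 * F + (y0 ^+ 2 + y0); pose c1 := G + (y1 ^+ 2 + y1).
have c0B : c0 \in (1%AS : {subfield L}) by rewrite !(rpredD, rpredM, rpredX).
have c1B : c1 \in (1%AS : {subfield L}) by rewrite !(rpredD, rpredM, rpredX).
have p2 : p ^+ 2 = p + (c0 + c1 * q).
  by rewrite /p yE /c0 /c1; ring: two0 qE rE.
have hP : hasval (2 * n) (c0 + c1 * q).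
  have := hasvalAS w_val (hasval_val w p0) n0.
  by rewrite p2 addrAC addxx add0r.
have PK : inKq (c0 + c1 * q) by exists c0, c1.
have [hc1 gc0] : hasval (2 * n) (c1 * q) /\ val_ge (2 * n + 1) c0.
  case: (inKq_hasval c0B c1B hP) => [[[i ni] _]|[_ ? ?]//].
  by case: (n4 i); move: ni; clear; lia.
have nE m : hasval m c1 -> 2 * n = m - 4 * f.
  by move=> hm; exact: hasval_uniq hc1 (hasvalM w_val hm valq).
(* Twice a valuation of K is a multiple of 16, so [y0^2 + y0] cannot cancel such a leading term,
   while [c0] must lie above [2 * n]. *)
have c0_odd m : hasval m (H + y1 ^+ 2 * F) -> m < 0 ->
    (forall i, m <> 16 * i) -> 2 * n + 1 <= m.
  move=> hm m0 mN; have [y00|m' mm hm'] := hasval_oddDAS w_val hm m0 (y := y0).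
    have [i ->] := base_val y0B y00; move: (mN i); clear; lia.
  by have := val_ge_le gc0 hm'; move: mm; clear; lia.
suff [b [bn bE]] : exists b : int, 2 * n = - (4 * b) /\
    (b = 2 * g + f /\ h <= f + g \/ b = 2 * h - f /\ f + g <= h).
  by exists y, p, (c0 + c1 * q), b; rewrite -bn.
have H_gt0 : 0 < h -> hasval (- (8 * h)) H.
  by case: valH => // -[_ ->]; rewrite ltxx.
have H_le0 : h <= 0 -> val_ge 0 H.
  move=> h0; case: valH => [[-> _]|hH]; first exact: val_ge0.
  by apply: hasval_ge hH _; move: h0; clear; lia.
(* For integral [y1], [G] dominates [c1]; then [f + g < h] would let [H] dominate [c0] and push it
   below [c1 * q]. *)
have [gy1|[m [m0 hy1]]] := val_geVhas w 0 y1.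
  have /nE nE1 : hasval (- (8 * g)) c1.
    apply: (hasvalDl w_val valG (val_geAS w_val gy1)).
    by move: g_gt0; clear; lia.
  exists (2 * g + f); split; first by move: nE1; clear; lia.
  left; split=> //; rewrite leNgt; apply/negP => fgh.
  have h0 : 0 < h by move: fgh f_gt0 g_gt0; clear; lia.
  have gy1F : val_ge (- (8 * f)) (y1 ^+ 2 * F).
    have := val_geM w_val (val_geX w_val 2 gy1) (hasval_ge valF (lexx _)).
    by rewrite mulr0 add0r.
  have lt : - (8 * h) < - (8 * f) by move: fgh g_gt0; clear; lia.
  have := c0_odd _ (hasvalDl w_val (H_gt0 h0) gy1F lt).
  have hN i : - (8 * h) <> 16 * i by move: (h_odd h0); clear; lia.
  have h1 : - (8 * h) < 0 by move: h0; clear; lia.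
  by move=> /(_ h1 hN); move: nE1 fgh h0 f_gt0; clear; lia.
have [i mE] : exists i, m = 8 * i.
  by have /andP[y10 /eqP <-] := hy1; exact: base_val.
have hy1F : hasval (16 * i - 8 * f) (y1 ^+ 2 * F).
  have := hasvalM w_val (hasvalX w_val 2 hy1) valF; congr hasval.
  by rewrite mE; clear; lia.
have hy1AS : hasval (16 * i) (y1 ^+ 2 + y1).
  have := hasvalAS w_val hy1 m0; congr hasval; rewrite mE; clear; lia.
have oddF j : 16 * i - 8 * f <> 16 * j by move: f_odd; clear; lia.
have i0 : i < 0 by move: m0; rewrite mE; clear; lia.
(* As [g] is odd, [y1^2] and [G] have different valuations, and the smaller gives that of [c1]. *)
have nE1 : 2 * i < - g /\ 2 * n = 16 * i - 4 * f \/
           - g < 2 * i /\ 2 * n = - (8 * g) - 4 * f.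
  have [lt|le] := ltP (16 * i) (- (8 * g)).
    left; split; first by move: lt; clear; lia.
    by apply: nE; exact: (hasvalDr w_val (hasval_ge valG (lexx _)) hy1AS lt).
  have lt : - (8 * g) < 16 * i by move: le g_odd; clear; lia.
  right; split; first by move: lt; clear; lia.
  by apply: nE; exact: (hasvalDl w_val valG (hasval_ge hy1AS (lexx _)) lt).
(* Here [H] and [y1^2 * F] have equal valuations and may cancel; the value [2 * h - f] arises in
   this case. *)
have [hE|hne] := eqVneq h (f - 2 * i).
  case: nE1 => -[lt nE1]; [exists (2 * h - f)|exists (2 * g + f)].
    by split; [|right; split=> //]; move: nE1 lt hE; clear; lia.
  by split; [|left; split=> //]; move: nE1 lt hE; clear; lia.
have [lt|le] := ltP (16 * i - 8 * f) (- (8 * h)).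
  have gH : exists2 m', 16 * i - 8 * f < m' & val_ge m' H.
    have [h0|h0] := leP h 0.
      exists 0; last exact: H_le0.
      by move: i0 f_gt0; clear; lia.
    by exists (- (8 * h)) => //; exact: hasval_ge (H_gt0 h0) (lexx _).
  have [m' lt' gH'] := gH.
  have := c0_odd _ (hasvalDr w_val gH' hy1F lt') _ oddF.
  have i1 : 16 * i - 8 * f < 0 by move: i0 f_gt0; clear; lia.
  move=> /(_ i1) le; case: nE1 => -[lt1 nE1].
    by move: nE1 le f_gt0; clear; lia.
  exists (2 * g + f); split; first by move: nE1; clear; lia.
  by left; split=> //; move: nE1 le lt lt1 f_gt0; clear; lia.
have lt : - (8 * h) < 16 * i - 8 * f by move: le hne; clear; lia.
have h0 : 0 < h by move: lt i0 f_gt0; clear; lia.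
have := c0_odd _ (hasvalDl w_val (H_gt0 h0) (hasval_ge hy1F (lexx _)) lt).
have hN j : - (8 * h) <> 16 * j by move: (h_odd h0); clear; lia.
have h0' : - (8 * h) < 0 by move: h0; clear; lia.
move=> /(_ h0' hN) le1; case: nE1 => -[lt1 nE1].
  by move: nE1 le1 lt f_gt0; clear; lia.
exists (2 * g + f); split; first by move: nE1; clear; lia.
by left; split=> //; move: nE1 le1 f_gt0; clear; lia.
Qed.

(** [x] is a best translate of [p] modulo K(q, v). All even integers are valuations on that field,
    so [w x] is odd, and [biquadratic_break] over K(q) with [N = 4] computes it. *)
Lemma exists_odd_generator (z : gal_of {:L}) (v V p P : L) (b1 b2 : int) :
  z q = q -> z v = v -> z p = p + 1 ->
  v ^+ 2 = v + V -> inKq V -> hasval (- (2 * b1)) v ->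
  0 < b1 -> ~~ (2 %| b1)%Z ->
  p ^+ 2 = p + P -> inKq P -> hasval (- (4 * b2)) P -> ~~ (2 %| b2)%Z ->
  b1 < b2 ->
  exists y x C D, [/\ z y = y /\ x = p + y, hasval (b1 - 2 * b2) x,
    x ^+ 2 = x + (C + D * v) /\ inKq C, inKq D
    & val_ge (2 * (b1 - 2 * b2) + 1) C /\
      hasval (2 * (b1 - 2 * b2)) (D * v)].
Proof.
move=> z_q z_v z_p v2 VK hv b1_gt0 b1_odd p2 PK hP b2_odd b12.
pose T y := exists a b, [/\ inKq a, inKq b & y = a + b * v].
have K0 : inKq 0 by apply: inKq_base; exact: rpred0.
have T_fixed y : T y -> z y = y.
  move=> [a [b [aK bK ->]]].
  by rewrite rmorphD /= rmorphM /= z_v !(inKq_fixed z_q).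
have [||||y [Ty x0 x_le0 x_best]] := @best_approximation T z p.
- by exists 0, 0; rewrite mul0r addr0.
- move=> c _ _ cB [a [b [aK bK ->]]] [a' [b' [aK' bK' ->]]].
  exists (a + c * a'), (b + c * b'); have cK := inKq_base cB.
  by split; [apply: inKqD => //; exact: inKqM|
             apply: inKqD => //; exact: inKqM|ring].
- exact: T_fixed.
- by [].
set x := p + y in x0 x_le0 x_best *; pose n := w x.
have hx : hasval n x := hasval_val w x0.
have n_odd i : n <> 2 * i.
  suff [t Tt /andP[t0 /eqP <-]] : exists2 t, T t & hasval (2 * i) t.
    exact: x_best.
  have [i2|i2] := boolP (2 %| i)%Z.
    have [t tK ht] := inKq_attains (divz i 2).
    exists t; first by exists t, 0; rewrite mul0r addr0.
    by move: ht; congr hasval; move: i2; clear; lia.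
  (* As [b1] is odd, multiples of [v] supply the valuations congruent to 2 modulo 4. *)
  have [t tK ht] := inKq_attains (divz (i + b1) 2).
  exists (t * v); first by exists 0, t; rewrite add0r.
  by have := hasvalM w_val ht hv; congr hasval; move: i2 b1_odd; clear; lia.
have n0 : n < 0 by move: x_le0 (n_odd 0); rewrite -/n; clear; lia.
have [a [b [aK bK yE]]] := Ty.
have xE : x = p + b * v + a by rewrite /x yE; ring.
have hV : hasval (- (4 * b1)) V.
  have v_lt0 : - (2 * b1) < 0 by move: b1_gt0; clear; lia.
  have := hasvalAS w_val hv v_lt0; rewrite v2 addrAC addxx add0r.
  by congr hasval; clear; lia.
have b2_gt0 : 0 < b2 := lt_trans b1_gt0 b12.
have n4 i : 2 * n <> 4 * i by move: (n_odd i); clear; lia.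
have [c [C [hb cE x2 [CK gC] hD]]] := biquadratic_break w_val two0
  (or_introl erefl) inKqD inKqM inKq_val v2 p2 VK PK bK aK hV b1_gt0 b1_odd hP
  b2_gt0 b2_odd xE hx n0 n4.
have c0 : c < 0 by move: cE b12; clear; lia.
have := hasvalM w_val (hasvalAS w_val hb c0) hv.
move=> /(hasval_uniq hD) nE.
have {}nE : n = b1 - 2 * b2 by move: nE cE; clear; lia.
rewrite nE in hx gC hD.
exists y, x, C, (b ^+ 2 + b); split=> //; first by split=> //; exact: T_fixed.
  by split=> //; rewrite -x2; ring: two0.
by apply: inKqD => //; exact: inKqM.
Qed.

(** A gain of [2 * J] on [v] becomes a gain of [J] on [x]: the Artin-Schreier equation of
    [rho x - x] has main term [D * (rho v - v)]. Its other terms vanish if [rho] fixes [q], and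
    otherwise gain at least [4 * f > 2 * J]. *)
Lemma gal_odd_generator_sub rho (v x C D : L) (b1 n J : int) :
  rho q = q \/ rho q = q + 1 /\ J < 2 * f ->
  x ^+ 2 = x + (C + D * v) -> inKq C -> inKq D ->
  hasval (- (2 * b1)) v -> hasval (2 * J - 2 * b1) (rho v - v) ->
  hasval (2 * n) (D * v) -> val_ge (2 * n + 1) C -> n + J < 0 ->
  hasval (n + J) (rho x - x).
Proof.
move=> rho_q x2 CK DK hv hdv hD gC nJ0.
have hDD : hasval (2 * n + 2 * b1) D.
  have D0 : D != 0.
    by apply: contraTneq hD => ->; rewrite mul0r /hasval eqxx.
  have := hasval_uniq hD (hasvalM w_val (hasval_val w D0) hv).
  move=> wD; have := hasval_val w D0; congr hasval.
  by move: wD; clear; lia.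
have dx : (rho x - x) ^+ 2 + (rho x - x) =
    D * (rho v - v) + ((rho C - C) + (rho D - D) * rho v).
  have := congr1 rho x2.
  rewrite rmorphXn rmorphD /= rmorphD /= rmorphM /= => x2'.
  by rewrite !subE; ring: two0 x2 x2'.
have hmain : hasval (2 * n + 2 * J) (D * (rho v - v)).
  by have := hasvalM w_val hDD hdv; congr hasval; clear; lia.
have hrest : val_ge (2 * n + 2 * J + 1) ((rho C - C) + (rho D - D) * rho v).
  case: rho_q => [rho_q|[rho_q J2f]].
    rewrite (inKq_fixed rho_q CK) (inKq_fixed rho_q DK).
    by rewrite !subrr mul0r addr0 val_ge0.
  have hrv : hasval (- (2 * b1)) (rho v).
    by rewrite (gal_hasval w_val dimL w_base).
  apply: val_geD => //.
    by apply: val_geW (inKq_gal_sub rho_q CK gC); move: J2f; clear; lia.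
  apply: val_geW (val_geM w_val (inKq_gal_sub rho_q DK (hasval_ge hDD (lexx _)))
    (hasval_ge hrv (lexx _))).
  by move: J2f; clear; lia.
have : hasval (2 * n + 2 * J) ((rho x - x) ^+ 2 + (rho x - x)).
  by rewrite dx; apply: (hasvalDl w_val hmain hrest); clear; lia.
have nJ : 2 * n + 2 * J < 0 by move: nJ0; clear; lia.
move=> /(hasvalASV w_val)/(_ nJ)[m mE]; congr hasval.
by move: mE; clear; lia.
Qed.

End DihedralElements.

(** If [xget] fell back on its default, the zero function, the ramification index would be 0 and not
    the positive dimension. *)
Lemma totally_ramified_valL (k : fieldType)
    (L : splittingFieldType (laurent k)) :
  totally_ramified L -> normalized_valuation (@valL k L) /\
  forall X : laurent k, X != 0 ->
    valL (X%:A : L) = (\dim {:L})%:Z * Defs.tval X.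
Proof.
rewrite /totally_ramified /ramification_index /valL.
case: xgetP => [w _ [wv [e e0 we]]|_] => [|/eqP]; last first.
  by rewrite eq_sym eqz_nat; have := adim_gt0 {:L}; case: (\dim _).
rewrite we ?lmonom_neq0// tval_lmonom mulr1 => eE.
by split=> // X X0; rewrite we// eE.
Qed.

(** * Lower ramification groups read off from one element of odd valuation *)

Section LowerGroup.
Variables (R : realType) (k : fieldType) (L : splittingFieldType (laurent k)).
Local Notation w := (@valL k L).
Hypotheses (w_val : normalized_valuation w) (dimL : \dim {:L} = 8%N).
Hypothesis w_base : forall X : laurent k, X != 0 -> w X%:A = 8 * Defs.tval X.
Hypothesis two0 : 2 = 0 :> L.

(** The cofactor of [eta] is a geometric sum congruent to [i] modulo the maximal ideal, hence a unit
    for odd [i]. *)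
Lemma subrX1_val (eta : L) (i : nat) (j : int) : hasval w j eta -> 0 < j ->
  val_ge w j ((1 + eta) ^+ i - 1) /\ (odd i -> hasval w j ((1 + eta) ^+ i - 1)).
Proof.
move=> heta j0; have g1 n : val_ge w 0 ((1 + eta) ^+ n).
  have h1 : hasval w 0 (1 + eta).
    exact: (hasvalDl w_val (hasval1 w_val) (hasval_ge heta (lexx _)) j0).
  by have := val_geX w_val n (hasval_ge h1 (lexx _)); rewrite mulr0.
have gj n : val_ge w j ((1 + eta) ^+ n - 1).
  rewrite subrX1 addrAC subrr add0r -[j]addr0.
  apply: val_geM (hasval_ge heta (lexx _)) _ => //.
  exact: val_ge_sum.
split=> // oi; rewrite subrX1 addrAC subrr add0r -[j]addr0.
apply: (hasvalM w_val heta); pose S := \sum_(n < i) ((1 + eta) ^+ n - 1).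
have -> : \sum_(n < i) (1 + eta) ^+ n = i%:R + S.
  rewrite /S sumrB sumr_const card_ord [RHS]addrC subrK.
  by [].
have -> : i%:R = 1 :> L.
  rewrite -(odd_double_half i) oi natrD -muln2 natrM two0 mulr0 addr0.
  by [].
by apply: (hasvalDl w_val (hasval1 w_val) _ j0); apply: val_ge_sum.
Qed.

(** [rho] multiplies [x^i] by [(1 + eta)^i]. A uniformizer [t^b * x^a] with [a] odd is moved by
    exactly [1 + j], which bounds [u]; conversely each term of the expansion of an integral element
    is moved by at least [1 + j]. *)
Lemma mem_lower_group (x : L) (rho : gal_of {:L}) (j : int) (u : R) :
  ~~ (2 %| w x)%Z -> x != 0 -> 0 < j -> hasval w (w x + j) (rho x - x) ->
  rho \in 'Gal({:L} / 1%AS)%g ->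
  (rho \in lower_group L u) = (Num.ceil u <= j).
Proof.
move=> x_odd x0 j0 hrho rhoG.
have cop : coprimez (w x) 8.
  rewrite coprimezE; change (coprime `|w x| (2 ^ 3)).
  by rewrite coprimeXr// coprimen2; move: x_odd; rewrite dvdzE dvdn2 negbK.
have hx := hasval_val w x0; pose eta := rho x / x - 1.
have heta : hasval w j eta.
  have := hasvalM w_val hrho (hasvalV w_val hx).
  by rewrite mulrBl mulfV//; congr hasval; clear; lia.
have rhox : rho x = x * (1 + eta) by rewrite /eta addrC subrK mulrC divfK.
have rho_term c i : rho (c *: x ^+ i) - c *: x ^+ i =
    c *: x ^+ i * ((1 + eta) ^+ i - 1).
  rewrite linearZ /= rmorphXn /= rhox exprMn -scalerAl -scalerBr mulrBr mulr1.
  by [].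
have hterm c i : c != 0 ->
    hasval w (8 * Defs.tval c + i%:Z * w x) (c *: x ^+ i).
  by move=> c0; exact: (hasvalZ w_val w_base c0 (hasvalX w_val i hx)).
rewrite inE rhoG /=; apply/asboolP/idP => [h|uj y y_ge0].
  have [a [b [aodd ab]]] : exists a : nat, exists b : int,
      odd a /\ 8 * b + a%:Z * w x = 1.
    have [t [a [wxE a7]]] : exists t, exists a, w x = 8 * t + a /\
        [\/ a = 1, a = 3, a = 5 | a = 7].
      exists (divz (w x) 8), (modz (w x) 8); split; first by clear; lia.
      have : [|| modz (w x) 8 == 1, modz (w x) 8 == 3, modz (w x) 8 == 5 |
              modz (w x) 8 == 7] by move: x_odd; clear; lia.
      by case/or4P => /eqP; [apply: Or41|apply: Or42|apply: Or43|apply: Or44].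
    (* Odd residues modulo 8 are their own inverses, so the exponent is the residue of [w x]. *)
    rewrite wxE; case: a7 => ->; [exists 1%N, (- t)|exists 3%N, (- 3 * t - 1)|
      exists 5%N, (- 5 * t - 3)|exists 7%N, (- 7 * t - 6)];
      by split=> //; clear; lia.
  have hy := hterm _ a (lmonom_neq0 k b); rewrite tval_lmonom ab in hy.
  have [_ /(_ aodd) ha] := subrX1_val a heta j0.
  have := hasvalM w_val hy ha; rewrite -rho_term => hy'.
  have := val_ge_le (h _ (hasval_ge hy _)) hy'; rewrite ler01 => /(_ isT).
  by clear; lia.
have [->|y0] := eqVneq y 0; first by rewrite rmorph0 subrr val_ge0.
have [c yE] := power_expansion w_val dimL w_base y cop x0.
have hc := power_sum_val w_val w_base cop x0 yE.
have wy : 0 <= w y by move: y_ge0; rewrite /val_ge (negbTE y0).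
rewrite yE rmorph_sum -sumrB; apply: (val_ge_sum w_val) => i _ /=.
rewrite rho_term.
have [->|ci] := eqVneq (c i) 0; first by rewrite scale0r mul0r val_ge0.
have [i0|i0] := eqVneq (i : nat) 0%N.
  by rewrite i0 expr0 subrr mulr0 val_ge0.
have hci := hterm _ i ci; have le := val_ge_le (hc i).1 hci.
have [gi _] := subrX1_val i heta j0.
apply: val_geW (val_geM w_val (hasval_ge hci (lexx _)) gi).
(* Valuation 0 is impossible for [0 < i < 8]; positivity of the term supplies the [+ 1] in the
   definition of the lower group. *)
have : 8 * Defs.tval (c i) + i%:Z * w x <> 0.
  move=> e0; have : (8 %| i%:Z * w x)%Z.
    by apply/dvdzP; exists (- Defs.tval (c i)); move: e0; clear; lia.
  rewrite Gauss_dvdzl 1?coprimez_sym//.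
  by move: i0 (ltn_ord i); clear; lia.
by move: uj le wy; clear; lia.
Qed.

End LowerGroup.

(** * The eight automorphisms through their action on q, s and r *)

Lemma artin_schreier_root (E : fieldType) (a x y : E) : 2 = 0 :> E ->
  x ^+ 2 = x + a -> y ^+ 2 = y + a -> y = x \/ y = x + 1.
Proof.
move=> two0 xa ya; have : (y + x) * (y + x + 1) = 0 by ring: two0 xa ya.
have addxx z : z + z = 0 :> E by rewrite -mulr2n -mulr_natl two0 mul0r.
have move_l b : y + b = 0 -> y = b.
  by move=> yb; rewrite -[y]addr0 -(addxx b) addrA yb add0r.
by move=> /eqP; rewrite mulf_eq0 -addrA => /orP[] /eqP/move_l; [left|right].
Qed.

Section GaloisGroup.
Variables (k : fieldType) (L : splittingFieldType (laurent k)).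
Hypothesis two0 : 2 = 0 :> L.
Variables (F G H q r s : L).
Hypotheses (FB : F \in 1%AS) (GB : G \in 1%AS) (HB : H \in 1%AS).
Hypotheses (qE : q ^+ 2 = q + F) (sE : s ^+ 2 = s + G).
Hypothesis rE : r ^+ 2 = r + (G * q + H).
Hypothesis genL : <<1 & [:: q; r; s]>>%VS = {:L}%VS.
Hypothesis card_gal : #|'Gal({:L} / 1%AS)%g| = 8%N.
Implicit Types rho : gal_of {:L}.

Lemma mem_gal1 rho : rho \in 'Gal({:L} / 1%AS)%g.
Proof.
rewrite gal_kHom ?sub1v//; apply/kHomP; split=> [x y _ _|x xB].
  by rewrite rmorphM.
exact: gal_base.
Qed.

Lemma gal_q rho : rho q = q \/ rho q = q + 1.
Proof.
apply: (artin_schreier_root two0 qE).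
by rewrite -rmorphXn qE rmorphD /= (gal_base _ FB).
Qed.

Lemma gal_s rho : rho s = s \/ rho s = s + 1.
Proof.
apply: (artin_schreier_root two0 sE).
by rewrite -rmorphXn sE rmorphD /= (gal_base _ GB).
Qed.

(* Since s^2 = s + G, adding s to r moves q to q + 1 in r^2 + r = G q + H. *)
Lemma gal_r rho (r' := if rho q == q then r else r + s) :
  rho r = r' \/ rho r = r' + 1.
Proof.
apply: (artin_schreier_root two0 (a := G * rho q + H)).
  rewrite /r'; case: (gal_q rho) => ->; first by rewrite eqxx.
  rewrite -subr_eq0 addrAC subrr add0r oner_eq0.
  by ring: two0 rE sE.
rewrite -rmorphXn rE !rmorphD /= rmorphM /=.
by rewrite (gal_base _ GB) (gal_base _ HB).
Qed.

(** Each bit separates the two roots of one Artin-Schreier equation; for [r] the reference root is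
    that of [gal_r], which depends on [rho q]. *)
Definition gal_code rho : bool * bool * bool :=
  (rho q == q, rho s == s, rho r == if rho q == q then r else r + s).

Lemma gal_eq_gen rho1 rho2 :
  rho1 q = rho2 q -> rho1 r = rho2 r -> rho1 s = rho2 s -> rho1 = rho2.
Proof.
move=> eq_q eq_r eq_s; pose rho := (rho1 * rho2^-1)%g.
have fix_rho x : rho1 x = rho2 x -> rho x = x.
  by move=> eq_x; rewrite galM ?memvf// eq_x -galM ?memvf// mulgV gal_id.
have : (<<1 & [:: q; r; s]>> <= fixedField [set rho])%VS.
  apply/Fadjoin_seqP; split; first exact: sub1v.
  move=> x; rewrite !inE => xqrs; apply/fixedFieldP; first exact: memvf.
  move=> t; rewrite inE => /eqP ->; apply: fix_rho.
  by case/or3P: xqrs => /eqP ->.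
rewrite genL => /subvP fixL; apply/eqP; rewrite eq_mulgV1.
apply/gal_eqP => x xL.
rewrite gal_id; have /mem_fixedFieldP[_] := fixL x xL.
by apply; rewrite inE.
Qed.

Lemma gal_code_inj : injective gal_code.
Proof.
have pick_eq (x y z : L) : (y = x \/ y = x + 1) -> (z = x \/ z = x + 1) ->
    (y == x) = (z == x) -> y = z.
  have x1 : (x + 1 == x) = false.
    by rewrite -subr_eq0 addrAC subrr add0r oner_eq0.
  by move=> [->|->] [->|->]; rewrite ?eqxx ?x1.
move=> rho1 rho2 [cq cs cr].
have eq_q := pick_eq _ _ _ (gal_q rho1) (gal_q rho2) cq.
apply: gal_eq_gen => //; last exact: pick_eq (gal_s rho1) (gal_s rho2) cs.
have r1 := gal_r rho1; have r2 := gal_r rho2.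
by rewrite eq_q in r1 cr; exact: pick_eq r1 r2 cr.
Qed.

Lemma gal_code_onto b : exists rho, gal_code rho = b.
Proof.
have le : (#|{: bool * bool * bool}| <= #|{: gal_of {:L}}|)%N.
  rewrite !card_prod card_bool -[(_ * _)%N]/8%N -card_gal.
  exact: max_card.
by have /codomP[rho ->] := inj_card_onto gal_code_inj le b; exists rho.
Qed.

Lemma card_gal_code (P : pred (bool * bool * bool)) :
  #|[set rho : gal_of {:L} | P (gal_code rho)]| =
  (P (true, true, true) + P (true, true, false) +
   (P (true, false, true) + P (true, false, false)) +
   (P (false, true, true) + P (false, true, false) +
   (P (false, false, true) + P (false, false, false))))%N.
Proof.
rewrite -(card_imset _ gal_code_inj).
have -> : [set gal_code x | x in [set rho | P (gal_code rho)]] = [set b | P b].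
  apply/setP => b; rewrite inE; apply/imsetP/idP => [[rho + ->]|Pb].
    by rewrite inE.
  by have [rho rb] := gal_code_onto b; exists rho; rewrite ?inE rb.
have sum_pair (T1 T2 : finType) (Q : T1 * T2 -> nat) :
    (\sum_b Q b = \sum_x \sum_y Q (x, y))%N.
  by rewrite pair_bigA; apply: eq_bigr => -[].
by rewrite -sum1dep_card big_mkcond /= !sum_pair !big_bool.
Qed.

End GaloisGroup.

(** * Orders of the lower ramification groups *)

Lemma two_eq0 (k : fieldType) (L : splittingFieldType (laurent k)) :
  2%N \in [pchar k] -> 2 = 0 :> L.
Proof.
move=> ck; have two0 : 2 = 0 :> laurent k.
  by apply: laurent_ext => n /=; rewrite addrr_pchar2.
by rewrite -(scaler_nat 2 (1 : L)) two0 scale0r.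
Qed.

(** Each non-identity automorphism has a jump, the gain in valuation from [x] to [rho x - x], and
    belongs to the groups up to that index. The code of the automorphism determines the jump, so the
    order is a count over codes. *)
Lemma lower_group_card (R : realType) (k : fieldType)
    (L : splittingFieldType (laurent k)) (F G H : laurent k) (q r s : L)
    (f := degtV F) (g := degtV G) (d := degtV (F + G)) (h := degtV H) :
  2%N \in [pchar k] -> totally_ramified L ->
  \dim {:L} = 8%N -> #|'Gal({:L} / 1%AS)%g| = 8%N ->
  q ^+ 2 + q = F%:A -> r ^+ 2 + r = G%:A * q + H%:A -> s ^+ 2 + s = G%:A ->
  <<1 & [:: q; r; s]>>%VS = {:L}%VS ->
  pos_odd f -> pos_odd g -> pos_odd d -> ~ pos_even h -> f <= g ->
  exists l1 l2 l3 : int,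
  [/\ [/\ l1 = Num.min d f, l2 = 2 * g - Num.min d f
        & l3 = 4 * Num.max (f + g) h - 2 * g - Num.min d f],
      0 < l1, l1 <= l2, l2 < l3
    & forall u : R, #|lower_group L u| =
        (1 + (Num.ceil u <= l3)%R + 2 * (Num.ceil u <= l2)%R
         + 4 * (Num.ceil u <= l1)%R)%N].
Proof.
move=> char_k ramL dimL card_gal eq_q eq_r eq_s genL.
move=> [f_gt0 f_odd] [g_gt0 g_odd] [d_gt0 d_odd] h_odd le_fg.
have two0 : 2 = 0 :> L := two_eq0 L char_k.
have [w_val w_base] := totally_ramified_valL ramL; rewrite dimL in w_base.
have sqE (x a : L) : x ^+ 2 + x = a -> x ^+ 2 = x + a.
  by move=> <-; ring: two0.
have {}eq_q := sqE _ _ eq_q; have {}eq_r := sqE _ _ eq_r.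
have {}eq_s := sqE _ _ eq_s.
have inB X : (X%:A : L) \in (1%AS : {subfield L}) by apply/vlineP; exists X.
have hbase X : 0 < degtV X -> hasval (@valL k L) (- (8 * degtV X)) X%:A.
  move=> X_gt0; rewrite -mulrN; apply: (hasval_base w_base).
  by apply: contraTneq X_gt0 => ->; rewrite degtV0.
have hF := hbase _ f_gt0; have hG := hbase _ g_gt0.
have hFG := hbase _ d_gt0; rewrite scalerDl in hFG.
have hH : (H%:A = 0 :> L /\ h = 0) \/ hasval (@valL k L) (- (8 * h)) H%:A.
  have [H0|H0] := eqVneq H 0; first by left; rewrite /h H0 scale0r degtV0.
  by right; rewrite -mulrN; exact: (hasval_base w_base).
have h_odd' : 0 < h -> ~~ (2 %| h)%Z.
  by move=> h0; apply/negP => h2; exact: h_odd.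
have onto := gal_code_onto two0 (inB F) (inB G) (inB H) eq_q eq_s eq_r genL
  card_gal.
have inj := gal_code_inj two0 (inB F) (inB G) (inB H) eq_q eq_s eq_r genL.
have galq := gal_q two0 (inB F) eq_q; have gals := gal_s two0 (inB G) eq_s.
have galr := gal_r two0 (inB F) (inB G) (inB H) eq_q eq_s eq_r.
have [tau [/eqP tau_q tau_s _]] := onto (true, false, true).
have {}tau_s : tau s = s + 1.
  by case: (gals tau) => // e; rewrite e eqxx in tau_s.
have [z zE] := onto (true, true, false).
have [/eqP z_q /eqP z_s z_r] := zE.
have {}z_r : z r = r + 1.
  by case: (galr z); rewrite z_q eqxx // => e; rewrite z_q eqxx e eqxx in z_r.
have [A [B [v [V [vA [vA1 [n [[AB BB vE] [v2 VK] [hv hA hA1] cases]]]]]]]] :=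
  exists_reduced_s w_val dimL w_base two0 (inB F) (inB G) eq_q eq_s f_gt0 f_odd
    g_gt0 g_odd d_gt0 d_odd le_fg hF hG hFG tau_q tau_s.
have [y [p [P [b2 [[yK pE] [p2 PK] hP b2E]]]]] :=
  exists_reduced_r w_val dimL w_base two0 (inB F) (inB G) (inB H) eq_q eq_r
    f_gt0 f_odd g_gt0 g_odd h_odd' hF hG hH z_q z_r.
(* Of the pair [q], [s], automorphisms moving [s] alone will have jump [b1], those moving [q] alone
   [Js], those moving both [Jst]. *)
have [b1 [Js [Jst [nE JsE JstE b1E]]]] : exists b1 Js Jst, [/\ n = - (2 * b1),
    vA = 2 * Js - 2 * b1, vA1 = 2 * Jst - 2 * b1
    & [/\ f < g, d = g, b1 = 2 * g - f, Js = f & Jst = f] \/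
      [/\ f = g, d <= f, b1 = d, Js = d & Jst = 2 * f - d]].
  case: cases => [[fg dg -> -> ->]|[fg df -> -> ->]].
    by exists (2 * g - f), f, f; split; [clear; lia..|left].
  by exists d, d, (2 * f - d); split; [clear; lia..|right].
have b1_gt0 : 0 < b1.
  by case: b1E => -[? ? -> _ _] //; move: le_fg f_gt0; clear; lia.
have b1_odd : ~~ (2 %| b1)%Z.
  by case: b1E => -[? ? -> _ _] //; move: f_odd; clear; lia.
have b2_odd : ~~ (2 %| b2)%Z.
  by case: b2E => -[-> _]; move: f_odd; clear; lia.
have b2_ge : 2 * g + f <= b2.
  by case: b2E => -[-> le]; move: le; clear; lia.
have b12 : b1 < b2.
  by case: b1E => -[fg df -> _ _]; move: b2_ge df le_fg f_gt0; clear; lia.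
rewrite nE in hv.
have z_v : z v = v.
  rewrite vE !rmorphD /= rmorphM /= z_q z_s.
  by rewrite (gal_base _ AB) (gal_base _ BB).
have z_p : z p = p + 1.
  rewrite pE rmorphD /= z_r (inKq_fixed z_q yK).
  by ring.
have [y2 [x [C [D [[z_y2 xE] hx [x2 CK] DK [gC hD]]]]]] :=
  exists_odd_generator w_val dimL w_base two0 (inB F) eq_q f_gt0 f_odd hF z_q z_v
    z_p v2 VK hv b1_gt0 b1_odd p2 PK hP b2_odd b12.
have [x0 /eqP wx] := andP hx.
have x_odd : ~~ (2 %| valL x)%Z by rewrite wx; move: b1_odd; clear; lia.
have mem_rho (J : int) (rho : gal_of {:L}) (u : R) :
    rho q = q \/ rho q = q + 1 /\ J < 2 * f ->
    hasval (@valL k L) (2 * J - 2 * b1) (rho v - v) ->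
    0 < J -> J < 2 * b2 - b1 ->
    (rho \in lower_group L u) = (Num.ceil u <= J).
  move=> rho_q hdv J0 Jlt.
  apply: (mem_lower_group w_val dimL w_base two0 u x_odd x0 J0 _
    (mem_gal1 rho)).
  rewrite wx; apply: (gal_odd_generator_sub w_val dimL w_base two0 eq_q f_gt0 f_odd
    hF rho_q x2 CK DK hv hdv hD gC).
  by move: Jlt; clear; lia.
(* [l3] is the jump of [z], since [z x - x = 1] has valuation 0 and [w x = - l3]. *)
pose l1 := Num.min d f; pose l3 := 2 * b2 - b1.
have l1E : l1 = if f < g then f else d.
  rewrite /l1; case: b1E => -[fg df _ _ _].
    by rewrite fg df min_r// ltW.
  by rewrite min_l// fg ltxx.
have lowerE (u : R) : lower_group L u = [set rho | match gal_code q r s rho with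
    | (true, true, true) => true
    | (true, true, false) => Num.ceil u <= l3
    | (true, false, _) => Num.ceil u <= b1
    | (false, true, _) => Num.ceil u <= Js
    | (false, false, _) => Num.ceil u <= Jst
    end].
  apply/setP => rho; rewrite [RHS]inE.
  have dv : rho v - v = (rho s - s) + A * (rho q - q).
    rewrite vE !rmorphD /= rmorphM /= (gal_base _ AB) (gal_base _ BB).
    by ring.
  case code: (gal_code q r s rho) => [[bq bs] br].
  have [cq cs _] := code.
  have rho_q : rho q = if bq then q else q + 1.
    rewrite -cq; case: (galq rho) => ->; first by rewrite eqxx.
    by rewrite -subr_eq0 addrAC subrr add0r oner_eq0.
  have rho_s : rho s = if bs then s else s + 1.
    rewrite -cs; case: (gals rho) => ->; first by rewrite eqxx.
    by rewrite -subr_eq0 addrAC subrr add0r oner_eq0.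
  rewrite rho_q rho_s in dv.
  case: bq bs code {cq cs} rho_q rho_s dv => [] [] code rho_q rho_s dv.
  - case: br code => code; last first.
      have -> : rho = z by apply: inj; rewrite code zE.
      apply: (mem_lower_group w_val dimL w_base two0 u x_odd x0 _ _
        (mem_gal1 z)).
        by rewrite /l3; move: b1_gt0 b12; clear; lia.
      rewrite xE rmorphD /= z_p z_y2 (_ : _ - _ = 1); last by ring.
      have -> : valL (p + y2) + l3 = 0 by rewrite -xE wx /l3; clear; lia.
      exact: hasval1.
    have -> : rho = 1%g by apply: inj; rewrite code /gal_code !gal_id !eqxx.
    rewrite inE mem_gal1 /=; apply/asboolP => t _.
    by rewrite gal_id subrr val_ge0.
  - apply: mem_rho; [by left| |exact: b1_gt0|by move: b12; clear; lia].
    have {}dv : rho v - v = 1 by rewrite dv; ring.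
    by rewrite dv subrr; exact: hasval1.
  - have J2f : 0 < Js < 2 * f.
      by case: b1E => -[_ df _ -> _]; move: df f_gt0 d_gt0; clear; lia.
    have /andP[J0 J1] := J2f; apply: mem_rho => //; first by right.
      have {}dv : rho v - v = A by rewrite dv; ring.
      by rewrite dv -JsE.
    by move: J1 b2_ge b12 le_fg f_gt0; clear; lia.
  - have J2f : 0 < Jst < 2 * f.
      by case: b1E => -[_ df _ _ ->]; move: df f_gt0 d_gt0; clear; lia.
    have /andP[J0 J1] := J2f; apply: mem_rho => //; first by right.
      have {}dv : rho v - v = A + 1 by rewrite dv; ring.
      by rewrite dv -JstE.
    by move: J1 b2_ge b12 le_fg f_gt0; clear; lia.
exists l1, (2 * g - l1), l3; split.
- split=> //; rewrite -/l1 /l3 l1E.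
  have b2max : b2 = 2 * Num.max (f + g) h - f.
    case: b2E => -[-> le]; [rewrite max_l//|rewrite max_r//].
    by clear; lia.
  rewrite b2max; case: b1E => -[fg df -> _ _]; first by rewrite fg; clear; lia.
  by rewrite fg ltxx -fg; clear; lia.
- by rewrite l1E; case: ifP.
- rewrite l1E; case: b1E => -[fg df _ _ _].
    by rewrite fg; move: fg; clear; lia.
  by rewrite fg ltxx -fg; move: df; clear; lia.
- rewrite /l3 l1E; case: b1E => -[fg df -> _ _].
    by rewrite fg; move: fg f_gt0 b2_ge; clear; lia.
  by rewrite fg ltxx -fg; move: df d_gt0 b2_ge; rewrite -fg; clear; lia.
move=> u; rewrite lowerE.
rewrite (card_gal_code two0 (inB F) (inB G) (inB H) eq_q eq_s eq_r genL card_gal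
  (fun b => match b with
    | (true, true, true) => true
    | (true, true, false) => Num.ceil u <= l3
    | (true, false, _) => Num.ceil u <= b1
    | (false, true, _) => Num.ceil u <= Js
    | (false, false, _) => Num.ceil u <= Jst
    end)).
(* If [f < g], the four automorphisms moving [q] share the jump [l1]. If [f = g], those moving
   exactly one of [q] and [s] have jump [d], and those moving both have jump [2 * g - d]. *)
rewrite l1E; case: b1E => -[fg df b1E' JsE' JstE'].
  by rewrite fg b1E' JsE' JstE'; clear; lia.
rewrite fg ltxx JsE' b1E' (_ : Jst = 2 * g - d); last by rewrite JstE' fg.
by clear; lia.
Qed.

(** * The Herbrand function and the upper numbering *)

Section Herbrand.
Variables (R : realType) (k : fieldType) (L : splittingFieldType (laurent k)).
Variables l1 l2 l3 : nat.
Hypotheses (l12 : (l1 <= l2)%N) (l23 : (l2 < l3)%N).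
Hypothesis card_gal : #|'Gal({:L} / 1%AS)%g| = 8%N.
Hypothesis card_lower : forall u : R, #|lower_group L u| =
  (1 + (Num.ceil u <= l3%:Z)%R + 2 * (Num.ceil u <= l2%:Z)%R
   + 4 * (Num.ceil u <= l1%:Z)%R)%N.
Implicit Types u nu : R.

(** This is the integral from 0 to [u] of the indicator of [t <= l], written as in
    [herbrand_phi]. *)
Lemma sum_steps (l m : nat) u : m%:R <= u -> u < m.+1%:R ->
  \sum_(1 <= i < m.+1) (i <= l)%N%:R + (u - m%:R) * (m.+1 <= l)%N%:R =
  Num.min u l%:R.
Proof.
have sumE n : \sum_(1 <= i < n.+1) (i <= l)%N%:R = (minn n l)%:R :> R.
  elim: n => [|n IH]; first by rewrite big_geq// min0n.
  by rewrite big_nat_recr//= IH -natrD; congr _%:R; lia.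
move=> mu um; rewrite sumE; have [ml|lm] := ltnP m l.
  have ul : u < l%:R by apply: lt_le_trans um _; rewrite ler_nat.
  rewrite min_l; last exact: ltW.
  by rewrite mulr1 addrC subrK.
have lu : l%:R <= u by apply: le_trans mu; rewrite ler_nat.
by rewrite min_r// mulr0 addr0.
Qed.

(** The order of the lower group is a combination of indicators with weights 1, 1, 2, 4; integrate
    each and divide by 8. The resulting weights sum to 1, so the formula also covers [u <= 0]. *)
Lemma herbrand_phiE u : herbrand_phi L u =
  u / 8 + Num.min u l3%:R / 8 + Num.min u l2%:R / 4 + Num.min u l1%:R / 2.
Proof.
rewrite /herbrand_phi; case: leP => u0.
  have ul l : u <= l%:R by apply: le_trans u0 _; rewrite ler0n.
  by rewrite !min_l//; lra.
have cardE (i : nat) : #|lower_group L (i%:R : R)|%:R =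
    1 + (i <= l3)%N%:R + 2 * (i <= l2)%N%:R + 4 * (i <= l1)%N%:R :> R.
  rewrite card_lower !ceil_le_int -!pmulrn !ler_nat !natrD; ring.
have /andP[mu um] := truncn_itv (ltW u0); move: (Num.truncn u) mu um => m mu um.
rewrite !cardE !leq0n (eq_bigr _ (fun i _ => cardE i)) !big_split /=.
rewrite -!mulr_sumr sumr_const_nat subn1 /= -[1 *+ m]/(m%:R).
rewrite -(sum_steps l1 mu um) -(sum_steps l2 mu um) -(sum_steps l3 mu um).
by field.
Qed.

Lemma herbrand_phi_lt u u' : u < u' -> herbrand_phi L u < herbrand_phi L u'.
Proof.
move=> uu'; rewrite !herbrand_phiE.
have minS l : Num.min u l <= Num.min u' l.
  by rewrite le_min !ge_min lexx (ltW uu') orbT.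
by have := (minS l1%:R, minS l2%:R, minS l3%:R) => -[[? ?] ?]; lra.
Qed.

Lemma herbrand_phi_le u u' :
  (herbrand_phi L u <= herbrand_phi L u') = (u <= u').
Proof.
have [uu'|u'u] := leP u u'; last first.
  by apply/negbTE; rewrite -ltNge herbrand_phi_lt.
move: uu'; rewrite le_eqVlt => /orP[/eqP ->|/herbrand_phi_lt/ltW//].
exact: lexx.
Qed.

Lemma herbrand_phi_onto nu : -1 <= nu ->
  exists u, -1 <= u /\ herbrand_phi L u = nu.
Proof.
have b12 : l1%:R <= l2%:R :> R by rewrite ler_nat.
have b23 : l2%:R <= l3%:R :> R by rewrite ler_nat ltnW.
have b0 : 0 <= l1%:R :> R by rewrite ler0n.
move: (l1%:R : R) (l2%:R : R) (l3%:R : R) (herbrand_phiE) b12 b23 b0.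
move=> a b c phiE ab bc a0 nu1.
(* The four linear pieces have slopes 1, 1/2, 1/4, 1/8 and meet at [a], [b], [c]; each witness
   inverts one piece. *)
have [h1|h1] := leP nu a.
  by exists nu; split=> //; rewrite phiE !min_l//; lra.
have [h2|h2] := leP (2 * nu) (a + b).
  exists (2 * nu - a); split; first lra.
  by rewrite phiE (min_r (y := a)) ?(min_l (y := b)) ?(min_l (y := c)); lra.
have [h3|h3] := leP (4 * nu) (c + b + 2 * a).
  exists (4 * nu - b - 2 * a); split; first lra.
  by rewrite phiE (min_r (y := a)) ?(min_r (y := b)) ?(min_l (y := c)); lra.
exists (8 * nu - c - 2 * b - 4 * a); split; first lra.
by rewrite phiE !min_r; lra.
Qed.

Lemma herbrand_psiP nu : -1 <= nu ->
  -1 <= herbrand_psi L nu /\ herbrand_phi L (herbrand_psi L nu) = nu.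
Proof.
move=> /herbrand_phi_onto ex; rewrite /herbrand_psi; set P := (X in xget 0 X).
by have : P (xget 0 P) by apply: xgetPex.
Qed.

(** [herbrand_phi] is strictly increasing and inverted by [herbrand_psi], so
    [herbrand_psi L nu <= l] means [nu <= herbrand_phi L l]. The exponent [4 - i] is [n + 1 - i] for
    order [2^3]. *)
Lemma breaks_of_card (i : nat) (l : nat) :
  (forall u, (2 ^ (4 - i) <= #|lower_group L u|)%N = (u <= l%:R)) ->
  lower_break L i (l%:R : R) /\ upper_break L i (herbrand_phi L (l%:R : R)).
Proof.
move=> cardE; have l1' : -1 <= l%:R :> R by apply: le_trans (ler0n _ l); lra.
have logE : (logn 2 #|'Gal({:L} / 1%AS)%g| + 1 - i = 4 - i)%N.
  by rewrite card_gal.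
rewrite /lower_break /upper_break /is_break logE; split; split.
- by split=> //; rewrite cardE.
- by move=> u [_]; rewrite cardE.
- have phi_ge : -1 <= herbrand_phi L (l%:R : R).
    have phiN1 : herbrand_phi L (-1 : R) = -1.
      by rewrite /herbrand_phi ifT//; lra.
    by rewrite -phiN1 herbrand_phi_le.
  split=> //; rewrite /upper_group cardE -herbrand_phi_le.
  by have [_ ->] := herbrand_psiP phi_ge.
- move=> nu [nu1]; rewrite /upper_group cardE -herbrand_phi_le.
  by have [_ ->] := herbrand_psiP nu1.
Qed.

Lemma breaks_dihedral :
  [/\ lower_break L 1 (l1%:R : R), lower_break L 2 (l2%:R : R)
    & lower_break L 3 (l3%:R : R)] /\
  [/\ upper_break L 1 (l1%:R : R), upper_break L 2 ((l1%:R + l2%:R) / 2 : R)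
    & upper_break L 3 ((2 * l1%:R + l2%:R + l3%:R) / 4 : R)].
Proof.
have b12 : l1%:R <= l2%:R :> R by rewrite ler_nat.
have b23 : l2%:R <= l3%:R :> R by rewrite ler_nat ltnW.
have ceilE u (l : nat) : (Num.ceil u <= l%:Z) = (u <= l%:R).
  by rewrite ceil_le_int.
have [low1 up1] : lower_break L 1 (l1%:R : R) /\
    upper_break L 1 (herbrand_phi L (l1%:R : R)).
  apply: breaks_of_card => u; rewrite card_lower -ceilE -[(2 ^ _)%N]/8%N.
  by move: (Num.ceil u) => c; clear -l12 l23; lia.
have [low2 up2] : lower_break L 2 (l2%:R : R) /\
    upper_break L 2 (herbrand_phi L (l2%:R : R)).
  apply: breaks_of_card => u; rewrite card_lower -ceilE -[(2 ^ _)%N]/4%N.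
  by move: (Num.ceil u) => c; clear -l12 l23; lia.
have [low3 up3] : lower_break L 3 (l3%:R : R) /\
    upper_break L 3 (herbrand_phi L (l3%:R : R)).
  apply: breaks_of_card => u; rewrite card_lower -ceilE -[(2 ^ _)%N]/2%N.
  by move: (Num.ceil u) => c; clear -l12 l23; lia.
split; split=> //.
- move: up1; congr upper_break; rewrite herbrand_phiE !min_l//; first lra.
  exact: le_trans b12 b23.
- move: up2; congr upper_break; rewrite herbrand_phiE (min_r b12) !min_l//.
  by lra.
- move: up3; congr upper_break; rewrite herbrand_phiE (min_r b23).
  by rewrite (min_r (le_trans b12 b23)) min_l//; lra.
Qed.

End Herbrand.

Theorem corollary5p18 (R : realType) (k : fieldType)
    (char_k : 2%N \in [pchar k])
    (L : splittingFieldType (laurent k))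
    (galL : galois 1%AS {:L})
    (ramL : totally_ramified L)
    (* 'D_8 is the dihedral group of order 8 *)
    (galD4 : ('Gal({:L} / 1%AS) \isog 'D_8)%g)
    (F G H : laurent k) (q r s : L)
    (eq_q : q ^+ 2 + q = F%:A)
    (eq_r : r ^+ 2 + r = G%:A * q + H%:A)
    (eq_s : s ^+ 2 + s = G%:A)
    (genL : <<1 & [:: q; r; s]>>%VS = {:L}%VS)
    (f := degtV F) (g := degtV G) (d := degtV (F + G)) (h := degtV H)
    (f_pos_odd : pos_odd f) (g_pos_odd : pos_odd g) (d_pos_odd : pos_odd d)
    (h_not_pos_even : ~ pos_even h)
    (le_fg : f <= g) :
  [/\ lower_break L 1 ((Num.min d f)%:~R : R),
      lower_break L 2 ((2 * g - Num.min d f)%:~R : R)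
    & lower_break L 3
        ((4 * Num.max (f + g) h - 2 * g - Num.min d f)%:~R : R)] /\
  [/\ upper_break L 1 ((Num.min d f)%:~R : R),
      upper_break L 2 (g%:~R : R)
    & upper_break L 3 ((Num.max (f + g) h)%:~R : R)].
Proof.
have card_gal : #|'Gal({:L} / 1%AS)%g| = 8%N.
  rewrite (card_isog galD4); exact: (@card_2dihedral 3).
have dimL : \dim {:L} = 8%N.
  by have := galois_dim galL; rewrite card_gal dimv1 divn1.
have [l1 [l2 [l3 [[l1E l2E l3E] l1_gt0 l12 l23 cardE]]]] :=
  lower_group_card R char_k ramL dimL card_gal eq_q eq_r eq_s genL f_pos_odd
    g_pos_odd d_pos_odd h_not_pos_even le_fg.
have nat_of l : 0 < l -> exists n : nat, l = n%:Z.
  by move=> l0; exists `|l|%N; move: l0; clear; lia.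
have [n1 n1E] := nat_of l1 l1_gt0.
have [n2 n2E] := nat_of l2 (lt_le_trans l1_gt0 l12).
have [n3 n3E] := nat_of l3 (lt_trans (lt_le_trans l1_gt0 l12) l23).
rewrite n1E n2E n3E in cardE l12 l23.
have [low up] := breaks_dihedral l12 l23 card_gal cardE.
rewrite -l3E -l2E -l1E n1E n2E n3E; split; first exact: low.
case: up => up1 up2 up3; split; first exact: up1.
- move: up2; congr upper_break.
  (* The minimum cancels in [l1 + l2], and below in [2 * l1 + l2 + l3]. *)
  have : n1%:Z + n2%:Z = 2 * g by rewrite -n1E -n2E l2E l1E; clear; lia.
  move/(congr1 (fun z => z%:~R : R)); rewrite rmorphD rmorphM /= => ->.
  by field.
move: up3; congr upper_break.
have : 2 * n1%:Z + n2%:Z + n3%:Z = 4 * Num.max (f + g) h.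
  by rewrite -n1E -n2E -n3E l3E l2E l1E; clear; lia.
move/(congr1 (fun z => z%:~R : R)); rewrite !rmorphD !rmorphM /= => ->.
by field.
Qed.
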